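(* Let $S^1=[0,1)$ with addition mod 1 and $T(x)=2x\pmod 1$. Let $J_1,J_2:S^1\to\mathbb{R}$ be positive Hölder continuous functions with $\sum_{x:\,T(x)=y}J_i(x)=1$ for all $y$, and let $\mu_i$ be the Gibbs probability for $\log J_i$ ($\mathcal{L}_{\log J_i}^*\mu_i=\mu_i$), $i=1,2$. If $\nu=\mu_1*\mu_2$, then $h(\nu)\ge h(\mu_2)$. Moreover, $h(\nu)>h(\mu_2)$ unless $\mu_1$ or $\mu_2$ is the Lebesgue probability.
   Context: The Ruelle operator is $\mathcal{L}_{\log J}(\varphi)(y)=\sum_{x:\,T(x)=y}J(x)\varphi(x)$ and $\mathcal{L}_{\log J}^*$ its dual on probabilities. Convolution: $\int\phi\,d(\eta*\mu)=\int\!\!\int\phi(x+y)\,d\mu(y)\,d\eta(x)$ (sums mod 1). $h$ denotes Kolmogorov–Sinai entropy with respect to $T$. *)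

(* Defs.v *)
From HB Require Import structures.
From mathcomp Require Import all_boot all_order all_algebra.
From mathcomp Require Import all_classical all_reals all_analysis.
Set Implicit Arguments. Unset Strict Implicit. Unset Printing Implicit Defensive.
Import Order.TTheory GRing.Theory Num.Theory.
Import numFieldNormedType.Exports.
Local Open Scope classical_set_scope.
Local Open Scope ring_scope.

(* The circle S^1 = [0,1) is represented inside the real line R (with its
   Borel sigma-algebra); all measures considered are probabilities on R
   concentrated on [0,1). *)

Section Circle.
Variable R : realType.

Definition I01 : set R := [set x | 0 <= x < 1].

Definition frac (x : R) : R := x - (Num.floor x)%:~R.

Definition dbl (x : R) : R := frac (2 * x).

Definition circ_dist (x y : R) : R := Num.min `|x - y| (1 - `|x - y|).

Definition holder_circle (J : R -> R) : Prop :=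
  exists (C a : R), 0 < a /\ a <= 1 /\
    forall x y, I01 x -> I01 y -> `|J x - J y| <= C * (circ_dist x y) `^ a.

(* the two preimages of y in [0,1) under the doubling map are y/2, (y+1)/2 *)
Definition normalized (J : R -> R) : Prop :=
  forall y, I01 y -> \sum_(x <- [:: y / 2; (y + 1) / 2]) J x = 1.

Definition ruelle (J phi : R -> R) (y : R) : R :=
  \sum_(x <- [:: y / 2; (y + 1) / 2]) J x * phi x.

Definition circ_continuous (phi : R -> R) : Prop :=
  continuous phi /\ forall x, phi (x + 1) = phi x.

Definition on_circle (mu : probability R R) : Prop := mu I01 = 1%E.

Definition gibbs (J : R -> R) (mu : probability R R) : Prop :=
  on_circle mu /\
  forall phi, circ_continuous phi ->
    (\int[mu]_(y in I01) (ruelle J phi y)%:E = \int[mu]_(y in I01) (phi y)%:E)%E.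

Definition convolution_of (mu1 mu2 nu : probability R R) : Prop :=
  forall A : set R, measurable A ->
    nu A = (\int[mu1]_(x in I01) mu2 [set y | I01 y /\ A (frac (x + y))])%E.

Definition is_lebesgue (mu : probability R R) : Prop :=
  forall A : set R, measurable A -> mu A = lebesgue_measure (A `&` I01).

Definition is_partition (k : nat) (P : 'I_k -> set R) : Prop :=
  (forall i, measurable (P i)) /\
  (forall i, P i `<=` I01) /\
  (forall i j, i != j -> P i `&` P j = set0) /\
  (forall x, I01 x -> exists i, P i x).

Definition join_cell (k n : nat) (P : 'I_k -> set R) (w : {ffun 'I_n -> 'I_k})
  : set R := [set x | I01 x /\ forall j : 'I_n, P (w j) (iter j dbl x)].

Definition eta (p : R) : R := if p == 0 then 0 else - (p * ln p).

Definition H_join (mu : probability R R) (k n : nat) (P : 'I_k -> set R) : R :=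
  \sum_(w : {ffun 'I_n -> 'I_k}) eta (fine (mu (join_cell P w))).

Definition h_part (mu : probability R R) (k : nat) (P : 'I_k -> set R) : R :=
  limn (fun n => H_join mu n P / n%:R).

Definition ks_entropy (mu : probability R R) : \bar R :=
  ereal_sup [set e | exists (k : nat) (P : 'I_k -> set R),
                       is_partition P /\ e = (h_part mu P)%:E].

End Circle.

(* Main.v *)
Require Import Defs.
From HB Require Import structures.
From mathcomp Require Import all_boot all_order all_algebra.
From mathcomp Require Import all_classical all_reals all_analysis.
From mathcomp Require Import measurable_realfun lra ring zify.
Import Order.TTheory GRing.Theory Num.Theory.
Local Open Scope classical_set_scope.
Local Open Scope ring_scope.

(** For a Gibbs measure of [log J], the two preimages of [T x] carry conditional
weights [J x] and [1 - J x] (lemma [gibbs_split]), so the binary entropy [b]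
gives [h(mu2) = k2 := \int b(J2) dmu2]; only [<=] is needed.  For the upper
bound, a finite partition [P] is compared through Gibbs' inequality with the
explicit weights [sum_{c < 2^n} prod_{j < n} J(c/2^(n-j)) r(w_j, c/2^(n-j))] on
words [w], where [r] is a conditional law of the [P]-label given the dyadic cell.

Let [X], [Y] be independent with laws [mu1], [mu2].  Given [(T X, T Y)], the
first binary digit of [X + Y] takes one of its values with probability
[J1 J2 + (1 - J1)(1 - J2)], a mixture of [J2] and [1 - J2].  Concavity of [b]
makes the entropy of this law at least [b(J2)], and since [c <= J1 <= 1 - c] even
at least [(1 - 2c) b(J2) + 2c ln 2].  Conditioning on less information increases
entropy, whence [h(nu) >= (1 - 2c) k2 + 2c ln 2 >= k2].  Finally [k2 <= ln 2],
with equality only if [J2 = 1/2] almost everywhere, and then [mu2] is invariant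
under [x |-> x + 1/2] and [T], which forces [F(t) = t] for its distribution
function [F]. *)

Import numFieldNormedType.Exports.
Set Implicit Arguments.
Unset Strict Implicit.
Unset Printing Implicit Defensive.

Local Notation frac := (@Defs.frac _).
Local Notation eta := (@Defs.eta _).
Local Notation S1 := (@I01 _).

(** * Periodic functions on the line *)

(** Each entropy is bounded from one side: that of [mu2] from above, over all partitions, that of
    [nu] from below, at the single partition [half]. The obstacle is that [h_part] is a bare [limn],
    whose convergence has to be earned. For the upper bound [H_join mu n P] is estimated by an
    affine function of [n], which settles the divergent case as well; for [half] the increments of
    [H_join] decrease, so their Cesàro means converge.

    Conditioning on T x takes the form of an integral identity: [x] may be redrawn as [x] or
    [x + 1 / 2] with weights [J x] and [1 - J x]. Mixtures, averages and the comparison with the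
    explicit weights all rest on one estimate, b(p) <= - p ln q - (1 - p) ln (1 - q), with [q]
    chosen so that equality holds at the average.

    The weights sample a preimage of 0 under T^n. Uniform continuity of ln J makes such a point as
    good as any other of its dyadic cell, except at the last few times, whose number does not depend
    on [n]. Functions are extended 1-periodically to the line, so that the points over [2 * x] are
    [x] and [x + 1 / 2] whatever the first digit of [x]. *)

Definition periodic {R : realType} {V : Type} (f : R -> V) :=
  forall x, f (x + 1) = f x.

Section Periodic.
Context {R : realType}.
Implicit Types (x y : R).

Lemma periodic_nat V (f : R -> V) (n : nat) x :
  periodic f -> f (x + n%:R) = f x.
Proof.
move=> pf; elim: n => [|n IH]; first by rewrite addr0.
by rewrite -natr1 addrA pf.
Qed.

Lemma periodic_int V (f : R -> V) (m : int) x :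
  periodic f -> f (x + m%:~R) = f x.
Proof.
move=> pf; case: m => n; first exact: periodic_nat.
by rewrite NegzE intrN -[in RHS](subrK n.+1%:R x) periodic_nat.
Qed.

Lemma periodic_frac V (f : R -> V) x : periodic f -> f (frac x) = f x.
Proof. by move=> pf; rewrite /Defs.frac -intrN periodic_int. Qed.

Lemma frac_I01 x : I01 (frac x).
Proof.
rewrite /I01 /Defs.frac /=; have := floor_itv x; rewrite intrD; lra.
Qed.

Lemma frac_id x : I01 x -> frac x = x.
Proof.
by rewrite /I01 /Defs.frac /= => xI; rewrite (@floor_def _ x 0) ?subr0// add0r.
Qed.

Lemma frac_periodic : periodic (@Defs.frac R).
Proof.
by move=> x; rewrite /Defs.frac floorDrz// floor1 intrD opprD addrACA subrr addr0.
Qed.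

Lemma periodic_comp_frac V (f : R -> V) : periodic (f \o frac).
Proof. by move=> x /=; rewrite frac_periodic. Qed.

Lemma periodic_pow2 V (f : R -> V) (n : nat) :
  periodic f -> periodic (fun x => f (2 ^+ n * x)).
Proof.
by move=> pf x /=; rewrite mulrDr mulr1 -natrX periodic_nat.
Qed.

Lemma iter_dbl n x : I01 x -> iter n (@dbl R) x = frac (2 ^+ n * x).
Proof.
move=> xI; elim: n => [|n IH]; first by rewrite /= expr0 mul1r frac_id.
rewrite iterS IH /dbl.
have := @periodic_frac R (fun y => frac (2 * y)) (2 ^+ n * x).
rewrite /= exprS mulrA => ->//.
by have /= := periodic_pow2 1 frac_periodic; rewrite expr1.
Qed.

Lemma measurable_frac : measurable_fun [set: R] (@Defs.frac R).
Proof.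
apply: measurable_funB => //.
by apply: nondecreasing_measurable => // x y xy; rewrite ler_int le_floor.
Qed.

Lemma measurable_I01 : measurable (@I01 R).
Proof.
rewrite [X in measurable X](_ : _ = `[0, 1[%classic); first exact: measurable_itv.
by apply/seteqP; split => x /=; rewrite in_itv.
Qed.

(** The two representatives differ by [x - y] up to an integer. If it is 0, the first term of the
    minimum is |x - y|; otherwise it is at least 1 in absolute value and the triangle inequality
    bounds the second term. *)
Lemma circ_dist_frac x y :
  0 <= circ_dist (frac x) (frac y) <= `|x - y|.
Proof.
rewrite /circ_dist.
have /= := frac_I01 x; have /= := frac_I01 y; rewrite /Defs.frac /I01 /=.
set m := Num.floor x; set n := Num.floor y => hy hx.
have -> : x - m%:~R - (y - n%:~R) = (x - y) - (m - n)%:~R.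
  by rewrite intrB; ring.
have hd : `|(x - y) - (m - n)%:~R| < 1.
  by rewrite intrB ltr_norml; lra.
have [mn|mn] := eqVneq (m - n) 0.
  rewrite mn subr0 in hd *.
  by rewrite le_min normr_ge0 subr_ge0 (ltW hd) /= ge_min lexx.
have hz : 1 <= `|(m - n)%:~R : R|.
  by rewrite -intr_norm -[1]/(1%:~R) ler_int -gtz0_ge1 normr_gt0.
apply/andP; split; first by rewrite le_min normr_ge0 /= subr_ge0 ltW.
rewrite ge_min; apply/orP; right.
have := lerB_dist (m - n)%:~R (x - y).
by rewrite distrC; lra.
Qed.

Lemma holder_unif_continuous (f : R -> R) (e : R) : holder_circle f -> 0 < e ->
  exists2 d, 0 < d & forall x y, `|x - y| < d ->
    `|f (frac x) - f (frac y)| < e.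
Proof.
move=> [C [a [a0 [a1 H]]]] e0.
(* [C] may be zero or negative; [K] is a positive constant above it, by which [e] can be divided. *)
pose K := `|C| + 1.
have K0 : 0 < K by rewrite ltr_pwDr.
pose d := (e / K) `^ a^-1.
exists d; first by rewrite powR_gt0// divr_gt0.
move=> x y xy.
have /andP[c0 c1] := circ_dist_frac x y.
rewrite /=; apply: (le_lt_trans (H _ _ (frac_I01 _) (frac_I01 _))).
have h1 : circ_dist (frac x) (frac y) `^ a <= `|x - y| `^ a.
  by apply: ge0_ler_powR => //; rewrite ?nnegrE// ltW.
have h2 : `|x - y| `^ a < d `^ a.
  by apply: gt0_ltr_powR; rewrite ?nnegrE ?powR_ge0.
have dE : d `^ a = e / K.
  by rewrite /d -powRrM mulVf ?gt_eqF// powRr1// divr_ge0// ltW.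
rewrite dE in h2.
apply: (@le_lt_trans _ _ (K * `|x - y| `^ a)).
  apply: (@le_trans _ _ (K * circ_dist (frac x) (frac y) `^ a)).
    by rewrite ler_wpM2r ?powR_ge0// /K (le_trans (ler_norm C))// lerDl.
  by rewrite ler_wpM2l// ltW.
by rewrite mulrC -ltr_pdivlMr.
Qed.

Lemma unif_continuous_continuous (f : R -> R) :
  (forall e, 0 < e -> exists2 d, 0 < d &
    forall x y, `|x - y| < d -> `|f x - f y| < e) -> continuous f.
Proof.
move=> H x; apply/cvgrPdist_lt => e /H[d d0 Hd]; near=> y.
by apply: Hd; near: y; apply: cvgr_dist_lt => //; exact: cvg_id.
Unshelve. all: by end_near. Qed.

End Periodic.

(** * Normalized densities and measures on the circle *)

(* The normalized densities (g-functions) of the doubling map, seen as 1-periodic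
   functions on the line; the first clause is uniform continuity. *)
Definition gdensity {R : realType} (J : R -> R) :=
  [/\ forall e, 0 < e -> exists2 d, 0 < d &
        forall x y, `|x - y| < d -> `|J x - J y| < e,
      periodic J, forall x, 0 < J x &
      forall x, J x + J (x + 1 / 2) = 1].

Section Density.
Context {R : realType}.

(** Normalization is applied at the double of [frac x], reduced by 1 when [frac x >= 1 / 2]; in that
    case [x] is the upper of the two preimages and the terms come in the other order. *)
Lemma gdensity_frac (J : R -> R) :
  (forall x, I01 x -> 0 < J x) -> holder_circle J -> normalized J ->
  gdensity (J \o frac).
Proof.
move=> J0 hJ nJ; split => [e e0||x|x] /=.
- exact: holder_unif_continuous.
- exact: periodic_comp_frac.
- exact/J0/frac_I01.
- have := frac_I01 x; rewrite /I01 /= => xI.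
  have E : frac (x + 1 / 2) = frac (frac x + 1 / 2).
    have <- := periodic_int (- Num.floor x) (x + 1 / 2) frac_periodic.
    by congr frac; rewrite [in RHS]/Defs.frac intrN; ring.
  have [x2|x2] := ltP (frac x) (1 / 2).
    have I : I01 (frac x * 2) by rewrite /I01 /=; lra.
    apply: (eq_trans _ (nJ _ I)); rewrite big_cons big_seq1.
    rewrite E (@frac_id R (frac x + 1 / 2)); last by rewrite /I01 /=; lra.
    by congr (J _ + J _); field.
  have I : I01 (frac x * 2 - 1) by rewrite /I01 /=; lra.
  apply: (eq_trans _ (nJ _ I)); rewrite big_cons big_seq1.
  have -> : frac (x + 1 / 2) = frac x - 1 / 2.
    rewrite E (_ : frac x + 1 / 2 = frac x - 1 / 2 + 1); last by field.
    by rewrite frac_periodic (@frac_id R (frac x - 1 / 2))// /I01 /=; lra.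
  by rewrite addrC; congr (J _ + J _); field.
Qed.

Lemma gdensity_continuous (J : R -> R) : gdensity J -> continuous J.
Proof. by case=> /unif_continuous_continuous. Qed.

Lemma gdensity_measurable (J : R -> R) : gdensity J -> measurable_fun setT J.
Proof. by move=> /gdensity_continuous; exact: continuous_measurable_fun. Qed.

Lemma gdensity_half (J : R -> R) x : gdensity J -> J (x + 1 / 2) = 1 - J x.
Proof. by case=> _ _ _ /(_ x); lra. Qed.

Lemma gdensity_itv (J : R -> R) x : gdensity J -> 0 < J x < 1.
Proof.
case=> _ _ J0 J1.
by have := J1 x; have := J0 x; have := J0 (x + 1 / 2); lra.
Qed.

Lemma gdensity_lbound (J : R -> R) : gdensity J ->
  exists c, [/\ 0 < c, c < 1 / 2 & forall x, c <= J x <= 1 - c].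
Proof.
move=> dJ; have [_ pJ J0 J1] := dJ.
have [|c0 cI H] := @EVT_min R J 0 1 ler01.
  by apply: continuous_subspaceT; exact: gdensity_continuous.
have Hc x : J c0 <= J x.
  rewrite -(periodic_frac x pJ); apply: H.
  by have := frac_I01 x; rewrite in_itv /I01 /=; lra.
(* [J c0] is the minimum of [J], at most 1/2; halving it keeps [c < 1 / 2] strict even for the
   constant density 1/2. *)
exists (J c0 / 2); have := J0 c0 => Jc.
split => [||x]; first by lra.
- by have := J1 c0; have := Hc (c0 + 1 / 2); lra.
- by have := J1 x; have := Hc x; have := Hc (x + 1 / 2); lra.
Qed.

Lemma ruelleE (J f : R -> R) y :
  ruelle J f y = J (y / 2) * f (y / 2) + J ((y + 1) / 2) * f ((y + 1) / 2).
Proof. by rewrite /ruelle big_cons big_seq1. Qed.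

End Density.

Section CircleMeasure.
Context {R : realType} (mu : probability R R).
Hypothesis muI : on_circle mu.
Local Open Scope ereal_scope.

Lemma circle_negligible : mu (~` S1) = 0.
Proof.
by rewrite probability_setC ?muI ?subee//; exact: measurable_I01.
Qed.

Lemma circle_integral (f : R -> \bar R) :
  measurable_fun setT f -> (forall x, 0 <= f x) ->
  \int[mu]_x f x = \int[mu]_(x in S1) f x.
Proof.
move=> mf f0.
have mI : measurable (~` @I01 R) by apply: measurableC; exact: measurable_I01.
rewrite (ge0_negligible_integral mI measurableT mf (fun x _ => f0 x) circle_negligible)//.
by rewrite setTD setCK.
Qed.

Lemma circle_measureI (A : set R) : measurable A -> mu (A `&` S1) = mu A.
Proof.
move=> mA; have mI : measurable (@I01 R) := measurable_I01.
rewrite -[in RHS](setIT A) -(setvU S1) setIUr measureU//.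
- rewrite [X in _ = X + _](_ : _ = 0) ?add0e//; apply/eqP; rewrite eq_le measure_ge0 andbT.
  rewrite -circle_negligible le_measure ?inE//.
  + by apply: measurableI => //; exact: measurableC.
  + exact: measurableC.
- by apply: measurableI => //; exact: measurableC.
- exact: measurableI.
- by rewrite setIACA setICl setI0.
Qed.

Lemma circle_measure_frac (A : set R) : measurable A ->
  mu [set x | A (frac x)] = mu A.
Proof.
move=> mA; have mA' : measurable [set x | A (frac x)].
  by rewrite -[X in measurable X]setTI; exact: measurable_frac.
rewrite -(circle_measureI mA) -(circle_measureI mA').
by congr (mu _); apply/seteqP; split => x /= [Ax Ix]; split => //;
  move: Ax; rewrite frac_id.
Qed.

Lemma circle_integral_indic (A : set R) : measurable A ->
  \int[mu]_x (\1_A (frac x))%:E = mu A.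
Proof.
move=> mA; rewrite -(circle_measure_frac mA).
have mA' : measurable [set x | A (frac x)].
  by rewrite -[X in measurable X]setTI; exact: measurable_frac.
by rewrite -[X in _ = mu X]setIT -integral_indic.
Qed.

End CircleMeasure.

(** * Gibbs measures *)

Lemma integral_eventually_eq {R : realType} (mu : probability R R)
    (u : nat -> R -> R) (f : R -> R) :
  (forall n, measurable_fun setT (u n)) -> (forall n x, 0 <= u n x) ->
  (forall x m n, (m <= n)%N -> u m x <= u n x) ->
  (forall x, \forall n \near \oo, u n x = f x) ->
  (\int[mu]_x (u n x)%:E @[n --> \oo] --> \int[mu]_x (f x)%:E)%E.
Proof.
move=> mu_ u0 und uf.
have -> : (\int[mu]_x (f x)%:E = \int[mu]_x limn (fun n => (u n x)%:E))%E.
  apply: eq_integral => x _; apply/esym/cvg_lim => //.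
  by apply: cvg_near_cst; have := uf x; apply: filterS => n ->.
apply: cvg_monotone_convergence => //.
- by move=> n; apply/measurable_EFinP.
- by move=> n x _; rewrite lee_fin.
- by move=> x _ m n mn; rewrite lee_fin und.
Qed.

Section GibbsMeasure.
Context {R : realType} (J : R -> R) (mu : probability R R).
Hypotheses (dJ : gdensity J) (muI : on_circle mu).

Let mJ : measurable_fun setT J := gdensity_measurable dJ.

Let J_gt0 x : (0 < J x). Proof. by case: dJ. Qed.

Let J_ge0 x : (0 <= J x). Proof. exact: ltW. Qed.

Let J_half x : (J (x / 2) + J ((x + 1) / 2) = 1).
Proof.
case: dJ => _ _ _ H; apply: (eq_trans _ (H (x / 2))).
by congr (_ + J _); field.
Qed.

Let mhalf (c : R) : measurable_fun setT (fun x : R => (x + c) / 2).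
Proof. by apply: measurable_funM => //; exact: measurable_funD. Qed.

Let mhalf0 : measurable_fun setT (fun x : R => x / 2).
Proof. exact: measurable_funM. Qed.

Lemma measurable_ruelle (f : R -> R) :
  measurable_fun setT f -> measurable_fun setT (ruelle J f).
Proof.
move=> mf; rewrite (_ : ruelle J f = fun y =>
    (J (y / 2) * f (y / 2) + J ((y + 1) / 2) * f ((y + 1) / 2))).
  apply: measurable_funD; apply: measurable_funM.
  - exact: (measurableT_comp mJ).
  - exact: (measurableT_comp mf).
  - exact: (measurableT_comp mJ).
  - exact: (measurableT_comp mf).
by apply/funext => y; rewrite ruelleE.
Qed.

Lemma ruelle_ge0 (f : R -> R) y :
  (forall x, 0 <= f x) -> (0 <= ruelle J f y).
Proof. by move=> f0; rewrite ruelleE addr_ge0// mulr_ge0. Qed.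

Lemma ruelle_periodic (f : R -> R) : periodic f -> periodic (ruelle J f).
Proof.
case: dJ => _ pJ _ _ pf y; rewrite !ruelleE addrC.
have -> : ((y + 1 + 1) / 2 = y / 2 + 1) by field.
by rewrite pf pJ.
Qed.

Lemma ruelle_cst c y : ruelle J (cst c) y = c.
Proof. by rewrite ruelleE /= -mulrDl J_half mul1r. Qed.

Lemma ruelle_comp_double (f : R -> R) y : periodic f ->
  ruelle J (fun x => f (2 * x)) y = f y.
Proof.
move=> pf; rewrite ruelleE.
have -> : (2 * (y / 2) = y) by field.
have -> : (2 * ((y + 1) / 2) = y + 1) by field.
by rewrite pf -mulrDl J_half mul1r.
Qed.

Hypothesis HG : forall phi : R -> R, continuous phi -> periodic phi ->
  (forall x, 0 <= phi x) ->
  (\int[mu]_y (ruelle J phi y)%:E = \int[mu]_y (phi y)%:E)%E.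

Let chi (A : set R) : R -> R := \1_A \o frac.

Let mchi A : measurable A -> measurable_fun setT (chi A).
Proof.
move=> mA; rewrite /chi.
exact: (measurableT_comp (measurable_indic mA) measurable_frac).
Qed.

Let int_chi A : measurable A -> (\int[mu]_x (chi A x)%:E = mu A)%E.
Proof. exact: circle_integral_indic. Qed.

Let ruelle_chi A y : ((ruelle J (chi A) y)%:E =
  (J (y / 2)%R)%:E * \d_(frac (y / 2)%R) A +
  (J ((y + 1) / 2)%R)%:E * \d_(frac ((y + 1) / 2)%R) A)%E.
Proof. by rewrite ruelleE. Qed.

(** Duality is given for continuous periodic functions. On the circle the ray is an arc from [a] to
    1, and 1 is the same point as 0, so the approximating functions have to vanish at both ends. For
    [a < 0] the arc is the whole circle. *)
Let gibbs_ray (a : R) :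
  (\int[mu]_y (ruelle J (chi `]a, +oo[%classic) y)%:E = mu `]a, +oo[%classic)%E.
Proof.
have mray : measurable (`]a, +oo[%classic : set R) by exact: measurable_itv.
have [a0|a0] := ltP a 0.
  have -> : chi `]a, +oo[%classic = cst 1.
    apply/funext => x; rewrite /chi /= indicE mem_set//= in_itv /= andbT.
    by have /andP[] := frac_I01 x; lra.
  rewrite -int_chi//; apply: eq_integral => y _; rewrite ruelle_cst.
  rewrite /chi /= indicE mem_set//= in_itv /= andbT.
  by have /andP[] := frac_I01 y; lra.
(* A tent over the arc; the truncations of [n * g] at 1 increase to the indicator and reach it at
   every point after finitely many steps. *)
pose g (x : R) : R := Num.max 0 (Num.min (x - a) (1 - x)).
have g0 x : (0 <= g x) by rewrite /g le_max lexx.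
have gL x y : g x <= g y + `|x - y|.
  have := ler_norm (x - y); have := ler_norm (y - x); rewrite distrC => h1 h2.
  have m1 : Num.min (x - a) (1 - x) <= x - a by rewrite ge_min lexx.
  have m2 : Num.min (x - a) (1 - x) <= 1 - x by rewrite ge_min lexx orbT.
  rewrite {1}/g ge_max addr_ge0//= -lerBlDr le_max le_min.
  by apply/orP; right; apply/andP; split; lra.
(* These bounds handle points that are close across 0, where both values of [g] are small. *)
have gub x : I01 x -> g x <= x /\ g x <= 1 - x.
  rewrite /I01 /= => xI.
  have m1 : Num.min (x - a) (1 - x) <= x - a by rewrite ge_min lexx.
  have m2 : Num.min (x - a) (1 - x) <= 1 - x by rewrite ge_min lexx orbT.
  by split; rewrite /g ge_max; lra.
have hg : holder_circle g.
  exists 1, 1; split => //; split => // x y xI yI.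
  have [[g1 g2] [g3 g4]] := (gub _ xI, gub _ yI).
  move: xI yI; rewrite /I01 /= => xI yI; rewrite mul1r powRr1; last first.
    by rewrite /circ_dist le_min normr_ge0 /= subr_ge0 ler_norml; lra.
  have := gL x y; have := gL y x; rewrite (distrC y) => L1 L2.
  have := g0 x; have := g0 y => g0y g0x.
  rewrite /circ_dist le_min; apply/andP; split.
    by rewrite ler_norml; lra.
  have [xy|xy] := leP x y.
    by rewrite [in X in _ <= X](distrC x) (ger0_norm (_ : 0 <= y - x)) ?ler_norml; lra.
  by rewrite (ger0_norm (_ : 0 <= x - y)) ?ler_norml; lra.
have gc : continuous (g \o frac).
  by apply: unif_continuous_continuous => e; exact: holder_unif_continuous.
pose phi n (x : R) : R := Num.min 1 (n%:R * g (frac x)).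
have phic n : continuous (phi n).
  move=> x; apply: (@continuous_min _ _ (cst 1)
    (fun x => n%:R * (g \o frac) x)); first exact: cvg_cst.
  by apply: cvgM; [exact: cvg_cst|exact: gc].
have phip n : periodic (phi n).
  by move=> x; rewrite /phi frac_periodic.
have phi0 n x : (0 <= phi n x) by rewrite /phi le_min ler01 mulr_ge0.
have phi_nd x m n : (m <= n)%N -> (phi m x <= phi n x).
  move=> mn; rewrite /phi le_min ge_min lexx /= ge_min; apply/orP; right.
  by rewrite ler_wpM2r// ler_nat.
have phi_chi x : \forall n \near \oo, phi n x = chi `]a, +oo[%classic x.
  rewrite /chi /= indicE; have [ax|ax] := ltP a (frac x); last first.
    near=> n; rewrite memNset /=; last by rewrite in_itv /=; lra.
    rewrite /phi (_ : g (frac x) = 0) ?mulr0 ?min_r//.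
    by rewrite /g max_l// ge_min subr_le0 ax.
  have gx : (0 < g (frac x)).
    have /andP[_ ?] := frac_I01 x.
    by rewrite /g lt_max lt_min !subr_gt0 ax; apply/orP; right.
  near=> n; rewrite mem_set /=; last by rewrite in_itv /= andbT.
  rewrite /phi min_l// -ler_pdivrMr//.
  by near: n; exact: nbhs_infty_ger.
rewrite -int_chi//.
have C1 : (\int[mu]_y (ruelle J (phi n) y)%:E @[n --> \oo] -->
    \int[mu]_y (ruelle J (chi `]a, +oo[%classic) y)%:E)%E.
  apply: (@integral_eventually_eq _ mu (fun n => ruelle J (phi n))) => [n|n x|x m n mn|x].
  - by apply: measurable_ruelle; exact: continuous_measurable_fun.
  - exact: ruelle_ge0.
  - by rewrite !ruelleE lerD// ler_wpM2l// phi_nd.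
  - near=> n; rewrite !ruelleE; congr (_ * _ + _ * _).
      by near: n; exact: phi_chi.
    by near: n; exact: phi_chi.
have C2 : (\int[mu]_y (ruelle J (phi n) y)%:E @[n --> \oo] -->
    \int[mu]_y (chi `]a, +oo[%classic y)%:E)%E.
  rewrite (_ : (fun n => _) = (fun n => (\int[mu]_y (phi n y)%:E)%E)); last first.
    by apply/funext => n; rewrite HG.
  by apply: integral_eventually_eq => // n; exact: continuous_measurable_fun.
exact: (cvg_unique _ C1 C2).
Unshelve. all: by end_near. Qed.

(** Rays are stable under intersection and generate the Borel sets, and both sides are additive in
    [A], so Dynkin induction starts from [gibbs_ray]. *)
Lemma gibbs_set A : measurable A ->
  (\int[mu]_y (ruelle J (chi A) y)%:E = mu A)%E.
Proof.
have setTE : (\int[mu]_y (ruelle J (chi setT) y)%:E = 1)%E.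
  have -> : chi setT = cst 1 by apply/funext => x; rewrite /chi /= indicE in_setT.
  under eq_integral do rewrite ruelle_cst.
  by rewrite integral_cst// mul1e; exact: probability_setT.
have mr A' : measurable A' ->
    measurable_fun setT (fun y => (ruelle J (chi A') y)%:E).
  by move=> mA'; apply/measurable_EFinP; apply: measurable_ruelle; exact: mchi.
have r0 A' y : (0 <= (ruelle J (chi A') y)%:E)%E.
  by rewrite lee_fin; exact: ruelle_ge0.
have E : @measurable _ R = <<s @RGenOInfty.G R >> by exact: RGenOInfty.measurableE.
rewrite E; move: A.
apply: (@dynkin_induction _ _ (@RGenOInfty.G R)
  (fun A => (\int[mu]_y (ruelle J (chi A) y)%:E = mu A)%E)).
- exact: E.
- move=> _ _ [x ->] [y ->]; exists (Num.max x y).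
  by apply/seteqP; split => z /=; rewrite !in_itv /= !andbT gt_max;
    [move=> [-> ->]|move=> /andP].
- by rewrite setTE; apply/esym; exact: probability_setT.
- by move=> _ [x ->]; exact: gibbs_ray.
- move=> S mS HS; rewrite probability_setC// -HS -setTE.
  rewrite -(_ : (\int[mu]_y ((ruelle J (chi S) y)%:E + (ruelle J (chi (~` S)) y)%:E) =
    \int[mu]_y (ruelle J (chi setT) y)%:E)%E); last first.
    apply: eq_integral => y _; rewrite !ruelleE -EFinD; congr EFin.
    rewrite /chi /= !indicE !in_setT !in_setC.
    by case: (_ \in S); case: (_ \in S) => /=; lra.
  rewrite ge0_integralD//; [|exact: mr|by apply: mr; exact: measurableC].
  by rewrite addeC addeK// HS fin_num_measure.
- move=> F mF tF HF.
  have mUF : measurable (\bigcup_k F k) by exact: bigcup_measurable.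
  rewrite measure_semi_bigcup//.
  rewrite -(eq_eseriesr (fun n _ => HF n)).
  rewrite -integral_nneseries//; last by move=> n; exact: mr.
  apply: eq_integral => y _; rewrite ruelle_chi !measure_semi_bigcup//.
  rewrite (eq_eseriesr (fun n _ => ruelle_chi (F n) y)).
  rewrite nneseriesD; [|by move=> *; rewrite mule_ge0// lee_fin..].
  by rewrite !nneseriesZl.
Qed.

(** The operator undoes composition with T, because the weights of the two preimages add up to 1;
    duality is then applied to the preimage of [A]. *)
Lemma gibbs_invariant A : measurable A -> mu [set x | A (frac (2 * x))] = mu A.
Proof.
move=> mA; have mA' : measurable [set x : R | A (frac (2 * x))].
  rewrite -[X in measurable X]setTI.
  apply: (measurableT_comp measurable_frac) => //; exact: measurable_funM.
rewrite -(gibbs_set mA') -(int_chi mA); apply: eq_integral => y _; congr EFin.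
rewrite -[RHS](ruelle_comp_double _ (periodic_comp_frac _)).
rewrite !ruelleE; have E x : chi [set x | A (frac (2 * x))] x = chi A (2 * x).
  rewrite /chi /= !indicE; congr (_%:R); congr nat_of_bool.
  apply/idP/idP; rewrite !inE /=; 
  have := @periodic_frac R _ (fun x => A (frac (2 * x))) x => ->//;
  by have := periodic_pow2 1 (periodic_comp_frac A); rewrite expr1.
by rewrite !E.
Qed.

Lemma gibbs_integral_double (f : R -> \bar R) : measurable_fun setT f ->
  periodic f -> (forall x, 0 <= f x)%E ->
  (\int[mu]_x f (2 * x)%R = \int[mu]_x f x)%E.
Proof.
move=> mf pf f0.
pose T (x : R) := frac (2 * x).
have mT : measurable_fun setT T.
  apply: (measurableT_comp measurable_frac) => //; exact: measurable_funM.
transitivity (\int[pushforward mu T]_x f x)%E.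
  rewrite ge0_integral_pushforward// preimage_setT.
  by apply: eq_integral => x _; rewrite /= /T periodic_frac.
by apply: eq_measure_integral => A mA _; exact: gibbs_invariant.
Qed.

Lemma gibbs_integral_pow2 n (f : R -> \bar R) : measurable_fun setT f ->
  periodic f -> (forall x, 0 <= f x)%E ->
  (\int[mu]_x f (2 ^+ n * x)%R = \int[mu]_x f x)%E.
Proof.
move=> mf pf f0; elim: n => [|n IH].
  by apply: eq_integral => x _; rewrite expr0 mul1r.
rewrite -IH -[RHS]gibbs_integral_double//.
- by apply: eq_integral => x _; rewrite exprSr mulrA.
- by apply: (measurableT_comp mf); exact: measurable_funM.
- exact: periodic_pow2.
Qed.

(** By invariance the Ruelle image may be integrated at [2 * x], whose preimages on the circle are
    [x] and [x + 1 / 2]. *)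
Lemma gibbs_split (A : set R) : measurable A ->
  (\int[mu]_x (J x * \1_A (frac x) + (1 - J x) * \1_A (frac (x + 1 / 2)))%:E
   = mu A)%E.
Proof.
move=> mA; rewrite -(gibbs_set mA).
rewrite -[RHS]gibbs_integral_double.
- apply: eq_integral => x _; congr EFin; rewrite ruelleE /chi /=.
  have -> : (2 * x / 2 = x) by field.
  have -> : ((2 * x + 1) / 2 = x + 1 / 2) by field.
  by rewrite (gdensity_half x dJ).
- by apply/measurable_EFinP; apply: measurable_ruelle; exact: mchi.
- by move=> x; congr EFin; apply: ruelle_periodic; exact: periodic_comp_frac.
- by move=> x; rewrite lee_fin; exact: ruelle_ge0.
Qed.

End GibbsMeasure.

(** * Dyadic cells and itineraries *)

Section EntropyInequalities.
Context {R : realType}.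
Implicit Types p q x : R.

Lemma ln_le_subr1 x : 0 < x -> ln x <= x - 1.
Proof.
by move=> x0; have := @le_ln1Dx R (x - 1); rewrite [1 + _]addrC subrK; apply; lra.
Qed.

(** Gibbs' inequality for one term, from [ln (q / p) <= q / p - 1]. When [p] and [q] run through two
    laws, the corrections [q - p] sum to 0. *)
Lemma eta_le p q : 0 <= p -> 0 < q -> eta p <= - (p * ln q) + (q - p).
Proof.
rewrite le_eqVlt => /predU1P[<-|p0] q0.
  by rewrite /Defs.eta eqxx mul0r subr0 oppr0 add0r ltW.
rewrite /Defs.eta gt_eqF//.
have h : ln (q / p) <= q / p - 1 by apply: ln_le_subr1; exact: divr_gt0.
have : p * ln (q / p) <= p * (q / p - 1) by rewrite ler_pM2l.
rewrite ln_div ?posrE// mulrBr mulrBr mulrCA divff ?gt_eqF// !mulr1; lra.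
Qed.

Lemma eta_ge0 p : 0 <= p <= 1 -> 0 <= eta p.
Proof.
move=> /andP[p0 p1]; rewrite /eta; case: ifP => // _.
by rewrite oppr_ge0 mulr_ge0_le0// ln_le0.
Qed.

Lemma ln_prod (I : Type) (s : seq I) (F : I -> R) : (forall i, 0 < F i) ->
  ln (\prod_(i <- s) F i) = \sum_(i <- s) ln (F i).
Proof.
move=> F0; elim: s => [|i s IH]; first by rewrite !big_nil ln1.
by rewrite !big_cons lnM ?posrE ?IH// prodr_gt0.
Qed.

End EntropyInequalities.

Section DyadicFloor.
Context {R : realType}.

Definition dyadic_floor (m : nat) (x : R) : R :=
  (Num.floor (2 ^+ m * x))%:~R / 2 ^+ m.

Lemma pow2_gt0 m : 0 < 2 ^+ m :> R. Proof. exact: exprn_gt0. Qed.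

Lemma pow2_neq0 m : 2 ^+ m != 0 :> R. Proof. by rewrite gt_eqF ?pow2_gt0. Qed.

Lemma dyadic_floor_itv m x : dyadic_floor m x <= x < dyadic_floor m x + (2 ^+ m)^-1.
Proof.
rewrite /dyadic_floor -{3}[(2 ^+ m)^-1]mul1r -mulrDl.
rewrite ler_pdivrMr ?pow2_gt0// ltr_pdivlMr ?pow2_gt0// [x * _]mulrC.
by have := floor_itv (2 ^+ m * x); rewrite intrD.
Qed.

Lemma dyadic_floorD1 m x : dyadic_floor m (x + 1) = dyadic_floor m x + 1.
Proof.
have i2 : (2 ^+ m : R) \is a Num.int by rewrite -natrX intr_nat.
by rewrite /dyadic_floor mulrDr mulr1 floorDrz// intrD (floorK i2) mulrDl divff ?pow2_neq0.
Qed.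

Lemma measurable_dyadic_floor m : measurable_fun setT (dyadic_floor m).
Proof.
apply: nondecreasing_measurable => // x y xy.
rewrite ler_pM2r ?invr_gt0 ?pow2_gt0// ler_int le_floor//.
by rewrite ler_pM2l ?pow2_gt0.
Qed.

(** With [2 ^+ n = 2 ^+ m * k], the lower bound holds because [k] times the coarse floor is an
    integer not above [2 ^+ n * x], hence not above the fine floor. *)
Lemma dyadic_floor_comp m n x : (m <= n)%N ->
  dyadic_floor m (dyadic_floor n x) = dyadic_floor m x.
Proof.
move=> mn; rewrite {1 3}/dyadic_floor; congr (_%:~R / _); apply/eqP.
rewrite floor_eq; have [k kE] : exists k : nat, 2 ^+ n = 2 ^+ m * k%:R :> R /\ (0 < k)%N.
  exists (2 ^ (n - m))%N; split; last by rewrite expn_gt0.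
  by rewrite natrX -exprD subnKC.
have /andP[h1 h2] := dyadic_floor_itv n x.
apply/andP; split; last first.
  apply: (@le_lt_trans _ _ (2 ^+ m * x)); first by rewrite ler_pM2l ?pow2_gt0.
  by have /andP[] := floor_itv (2 ^+ m * x).
case: kE => kE k0; rewrite /dyadic_floor kE.
set f := (Num.floor (2 ^+ m * k%:R * x))%:~R.
have -> : 2 ^+ m * (f / (2 ^+ m * k%:R)) = f / k%:R.
  by field; rewrite pow2_neq0 pnatr_eq0 -lt0n k0.
rewrite ler_pdivlMr ?ltr0n// /f -[k%:R in X in X <= _]/((Posz k)%:~R) -intrM.
rewrite ler_int floor_ge_int intrM [_ * k%:R * x]mulrAC.
by rewrite ler_pM2r ?ltr0n//; exact: floor_le.
Qed.

End DyadicFloor.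

Lemma measurable_iter_dbl {R : realType} n :
  measurable_fun setT (iter n (@dbl R)).
Proof.
elim: n => [|n IH]; first exact: measurable_id.
apply: (measurableT_comp _ IH).
by apply: (measurableT_comp measurable_frac); exact: measurable_funM.
Qed.

(** * Words, itineraries and cells of a joined partition *)

Section JoinCell.
Context {R : realType} (mu : probability R R) (k : nat) (P : 'I_k -> set R).
Hypotheses (muI : on_circle mu) (partP : is_partition P).

Lemma partition_index : {f : R -> 'I_k | forall x i, P i (frac x) <-> i = f x}.
Proof.
have [_ [_ [dP cP]]] := partP.
have [f Hf] := choice (fun x => cP _ (frac_I01 x)).
exists f => x i; split => [Pi|->]; last exact: Hf.
apply/eqP; apply: contrapT => /negP /dP; apply/eqP/set0P.
by exists (frac x).
Qed.

Definition part_index := sval partition_index.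

Lemma part_indexP x i : P i (frac x) <-> i = part_index x.
Proof. exact: (svalP partition_index). Qed.

Lemma part_index_periodic : periodic part_index.
Proof.
by move=> x; apply/esym/part_indexP; rewrite frac_periodic; apply/part_indexP.
Qed.

Definition itinerary n (x : R) : {ffun 'I_n -> 'I_k} :=
  [ffun j : 'I_n => part_index (2 ^+ j * x)].

Lemma join_cellP n (w : {ffun 'I_n -> 'I_k}) x : I01 x ->
  join_cell P w x <-> w = itinerary n x.
Proof.
move=> xI; split => [[_ H]|->].
  apply/ffunP => j; rewrite ffunE; apply/part_indexP.
  by rewrite -iter_dbl.
by split => // j; rewrite iter_dbl// ffunE; apply/part_indexP.
Qed.

Lemma measurable_join_cell n (w : {ffun 'I_n -> 'I_k}) :
  measurable (join_cell P w).
Proof.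
have [mP _] := partP.
(* The conditions with [j >= n] are vacuous, so the finite intersection becomes a countable one. *)
rewrite [X in measurable X](_ : _ = @I01 R `&` \bigcap_(j in setT)
  [set x | forall h : (j < n)%N, P (w (Ordinal h)) (iter j (@dbl R) x)]).
  apply: measurableI; first exact: measurable_I01.
  apply: bigcapT_measurable => j; have [jn|jn] : (j < n)%N \/ (n <= j)%N by case: (ltnP j n); [left|right].
    rewrite [X in measurable X](_ : _ =
      [set x | P (w (Ordinal jn)) (iter j (@dbl R) x)]).
      rewrite -[X in measurable X]setTI.
      exact: (measurable_iter_dbl (R := R) j measurableT (mP (w (Ordinal jn)))).
    apply/seteqP; split => x /= H; first exact: H.
    by move=> h; rewrite (bool_irrelevance h jn).
  rewrite [X in measurable X](_ : _ = setT)//.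
  by apply/seteqP; split => x //= _ h; move: jn; rewrite leqNgt h.
apply/seteqP; split => x [xI H]; split => //.
  by move=> j _ h; exact: (H (Ordinal h)).
move=> j; have := H j I (ltn_ord j); congr (P (w _) _); exact/val_inj.
Qed.

Lemma sum_join_cell n (G : {ffun 'I_n -> 'I_k} -> R) x : I01 x ->
  \sum_w G w * \1_(join_cell P w) x = G (itinerary n x).
Proof.
move=> xI; rewrite (bigD1 (itinerary n x))//= big1 ?addr0.
  by rewrite indicE mem_set ?mulr1//; exact/join_cellP.
move=> w wi; rewrite indicE memNset ?mulr0//.
by move=> /(join_cellP _ xI) E; rewrite E eqxx in wi.
Qed.

Lemma integral_join_cell n (G : {ffun 'I_n -> 'I_k} -> R) :
  (forall w, 0 <= G w) ->
  ((\sum_w G w * fine (mu (join_cell P w)))%:E =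
   \int[mu]_x (\sum_w G w * \1_(join_cell P w) x)%:E)%E.
Proof.
move=> G0; rewrite -sumEFin.
under [RHS]eq_integral do rewrite -sumEFin.
rewrite ge0_integral_sum//.
- apply: eq_bigr => w _.
  have mw := measurable_join_cell w.
  rewrite EFinM fineK ?fin_num_measure//.
  under eq_integral do rewrite EFinM.
  rewrite ge0_integralZl_EFin//.
  + by rewrite integral_indic// setIT.
  + by apply/measurable_EFinP; exact: measurable_indic.
- move=> w; apply/measurable_EFinP; apply: measurable_funM => //.
  by apply: measurable_indic; exact: measurable_join_cell.
- by move=> w x _; rewrite lee_fin mulr_ge0.
Qed.

Lemma sum_measure_join_cell n :
  \sum_(w : {ffun 'I_n -> 'I_k}) fine (mu (join_cell P w)) = 1.
Proof.
apply: EFin_inj; under eq_bigr do rewrite -[fine _]mul1r.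
rewrite integral_join_cell// circle_integral//.
- rewrite -[RHS]muI -[mu _]mul1e -integral_cst; last exact: measurable_I01.
  by apply: eq_integral => x; rewrite inE => xI; rewrite sum_join_cell.
- apply/measurable_EFinP; apply: measurable_sum => w.
  apply: measurable_funM => //.
  by apply: measurable_indic; exact: measurable_join_cell.
- by move=> x; rewrite lee_fin sumr_ge0// => w _; rewrite mul1r.
Qed.

(* Gibbs' inequality, in integrated form. *)
Lemma H_join_le_integral n (q : {ffun 'I_n -> 'I_k} -> R) (Phi : R -> R) :
  (forall w, 0 < q w) -> \sum_w q w = 1 ->
  measurable_fun setT Phi -> (forall x, 0 <= Phi x) ->
  (forall x, I01 x -> - ln (q (itinerary n x)) <= Phi x) ->
  ((H_join mu n P)%:E <= \int[mu]_x (Phi x)%:E)%E.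
Proof.
move=> q0 q1 mPhi Phi0 H.
have q_le1 w : q w <= 1.
  by rewrite -q1 (bigD1 w)//= lerDl sumr_ge0// => v _; exact: ltW.
apply: (@le_trans _ _
    (\sum_w - ln (q w) * fine (mu (join_cell P w)))%:E); last first.
  rewrite integral_join_cell; last by move=> w; rewrite oppr_ge0 ln_le0.
  rewrite !circle_integral//.
  - apply: ge0_le_integral.
    + exact: measurable_I01.
    + move=> x _; rewrite lee_fin sumr_ge0// => w _.
      by rewrite mulr_ge0// oppr_ge0 ln_le0.
    + apply/measurable_EFinP; apply: measurable_sum => w.
      apply: measurable_funM => //.
      by apply: measurable_indic; exact: measurable_join_cell.
    + by apply/measurable_EFinP; exact: measurable_funTS.
    + by move=> x xI; rewrite lee_fin sum_join_cell ?H.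
  - exact/measurable_EFinP.
  - apply/measurable_EFinP; apply: measurable_sum => w.
    apply: measurable_funM => //.
    by apply: measurable_indic; exact: measurable_join_cell.
  - move=> x; rewrite lee_fin sumr_ge0// => w _.
    by rewrite mulr_ge0// oppr_ge0 ln_le0.
rewrite lee_fin; apply: (@le_trans _ _ (\sum_w (- (fine (mu (join_cell P w)) * ln (q w))
    + (q w - fine (mu (join_cell P w)))))).
  by apply: ler_sum => w _; apply: eta_le => //; exact: fine_ge0.
rewrite big_split /= sumrB q1 sum_measure_join_cell subrr addr0.
by apply: ler_sum => w _; rewrite mulNr mulrC.
Qed.

End JoinCell.

(** * Upper bound for the entropy of a Gibbs measure *)

(** The points [c / 2 ^ n] are the preimages of 0 under T^n and the product runs along the orbit, so
    the sum is the n-th Ruelle iterate of 1 at 0. In the induction [c] and [c + 2 ^ n] share every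
    factor but the first, where their points differ by 1/2. *)
Lemma sum_dyadic_prod {R : realType} (J : R -> R) n : gdensity J ->
  \sum_(0 <= c < 2 ^ n) \prod_(j < n) J (c%:R / 2 ^+ (n - j)) = 1.
Proof.
move=> dJ; have [_ pJ _ J1] := dJ; elim: n => [|n IH].
  by rewrite expn0 big_nat1 big_ord0.
rewrite expnS mul2n -addnn (@big_cat_nat _ _ _ (2 ^ n)%N) ?leq_addr//=.
rewrite -{2}[(2 ^ n)%N]add0n big_addn addnK -big_split /= -[RHS]IH.
apply: eq_bigr => c _; rewrite !big_ord_recl /= !subn0.
rewrite [X in _ * X + _](_ : _ = \prod_(j < n) J (c%:R / 2 ^+ (n - j))); last first.
  by apply: eq_bigr => j _; rewrite /bump /= add1n subSS.
rewrite [X in _ + _ * X](_ : _ = \prod_(j < n) J (c%:R / 2 ^+ (n - j))); last first.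
  apply: eq_bigr => j _; rewrite /bump /= add1n subSS natrD mulrDl natrX.
  rewrite -[in X in _ + X / _](subnK (ltnW (ltn_ord j))) exprD mulrAC divff ?pow2_neq0//.
  by rewrite mul1r -[2 ^+ j]natrX periodic_nat.
rewrite -mulrDl [X in X * _](_ : _ = 1) ?mul1r//.
rewrite -[RHS](J1 (c%:R / 2 ^+ n.+1)); congr (_ + J _).
by rewrite natrD mulrDl natrX exprS; congr (_ + _); field; rewrite pow2_neq0.
Qed.

(** * A reference law on words *)

Section Weights.
Context {R : realType} (J : R -> R) (mu : probability R R).
Context (k : nat) (P : 'I_k -> set R) (r : 'I_k -> R -> R).
Hypotheses (dJ : gdensity J) (muI : on_circle mu) (partP : is_partition P).
Hypothesis HG : forall phi : R -> R, continuous phi -> periodic phi ->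
  (forall x, 0 <= phi x) ->
  (\int[mu]_y (ruelle J phi y)%:E = \int[mu]_y (phi y)%:E)%E.
Hypotheses (r0 : forall i x, 0 < r i x) (r1 : forall x, \sum_i r i x = 1).
Hypotheses (pr : forall i, periodic (r i)).
Hypotheses (mr : forall i, measurable_fun setT (r i)).

Let J0 x : 0 < J x. Proof. by case: dJ. Qed.

Let J_le1 x : J x <= 1.
Proof. by case: dJ => _ _ J0' /(_ x) <-; rewrite lerDl ltW. Qed.

Let r_le1 i x : r i x <= 1.
Proof. by rewrite -(r1 x) (bigD1 i)//= lerDl sumr_ge0// => j _; rewrite ltW. Qed.

(** The law of a random word: draw an [n]-digit dyadic point with the probabilities of
    [sum_dyadic_prod], then independently at each time [j] a label with law [r] at the j-th point of
    its orbit. *)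
Definition weight n (w : {ffun 'I_n -> 'I_k}) : R :=
  \sum_(0 <= c < 2 ^ n) \prod_(j < n)
    (J (c%:R / 2 ^+ (n - j)) * r (w j) (c%:R / 2 ^+ (n - j))).

Lemma sum_weight n : \sum_(w : {ffun 'I_n -> 'I_k}) weight w = 1.
Proof.
rewrite exchange_big /= -[RHS](sum_dyadic_prod n dJ); apply: eq_bigr => c _.
rewrite -(bigA_distr_bigA (fun (j : 'I_n) i =>
  J (c%:R / 2 ^+ (n - j)) * r i (c%:R / 2 ^+ (n - j)))) /=.
by apply: eq_bigr => j _; rewrite -mulr_sumr r1 mulr1.
Qed.

Lemma weight_gt0 n (w : {ffun 'I_n -> 'I_k}) : 0 < weight w.
Proof.
rewrite /weight big_mkord.
have h : (0 < 2 ^ n)%N by rewrite expn_gt0.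
rewrite (bigD1 (Ordinal h))//= ltr_pwDl// ?prodr_gt0// => [j _|].
  exact: mulr_gt0.
by apply: sumr_ge0 => c _; apply: prodr_ge0 => j _; rewrite ltW// mulr_gt0.
Qed.

(** The cost of one letter in the logarithm of the weight when [m] binary digits of its point are
    known; the indicators select the label of [x]. *)
Definition theta m (x : R) : R := \sum_i \1_(P i) (frac x) *
  - ln (J (dyadic_floor m x) * r i (dyadic_floor m x)).

Lemma theta_ge0 m x : 0 <= theta m x.
Proof.
apply: sumr_ge0 => i _; rewrite mulr_ge0// oppr_ge0 ln_le0//.
by rewrite mulr_ile1// ltW.
Qed.

Lemma thetaE m x : theta m x =
  - ln (J (dyadic_floor m x) * r (part_index partP x) (dyadic_floor m x)).
Proof.
rewrite /theta (bigD1 (part_index partP x))//= big1 ?addr0.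
  by rewrite indicE mem_set ?mul1r//; exact/part_indexP.
move=> i ne; rewrite indicE memNset ?mul0r//.
by move=> /(part_indexP partP) E; rewrite E eqxx in ne.
Qed.

Lemma theta_periodic m : periodic (theta m).
Proof.
move=> x; rewrite !thetaE part_index_periodic dyadic_floorD1 pr.
by case: dJ => _ ->.
Qed.

Lemma measurable_theta m : measurable_fun setT (theta m).
Proof.
have [mP _] := partP.
apply: measurable_sum => i; apply: measurable_funM.
  exact: (measurableT_comp (measurable_indic (mP i)) measurable_frac).
apply: measurableT_comp => //; apply: (measurableT_comp (@measurable_ln R)).
apply: measurable_funM.
  exact: (measurableT_comp (gdensity_measurable dJ) (measurable_dyadic_floor m)).
exact: (measurableT_comp (mr i) (measurable_dyadic_floor m)).
Qed.

(** Only one term of the weight is kept, that of the dyadic cell containing [x]. After [j] doublings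
    [n - j] digits are left, whence the level. *)
Lemma ln_weight_le n x : I01 x ->
  - ln (weight (itinerary partP n x)) <= \sum_(j < n) theta (n - j) (2 ^+ j * x).
Proof.
move=> xI.
have [c cE] : exists c : nat, Num.floor (2 ^+ n * x) = c%:Z.
  have : 0 <= Num.floor (2 ^+ n * x).
    by rewrite floor_ge0 mulr_ge0 ?exprn_ge0//; case/andP: xI.
  by case: (Num.floor _) => // c _; exists c.
have cn : (c < 2 ^ n)%N.
  have /andP[h _] := floor_itv (2 ^+ n * x); rewrite cE in h.
  rewrite -(ltr_nat R) natrX; apply: (le_lt_trans h).
  by rewrite -[X in _ < X]mulr1 ltr_pM2l ?pow2_gt0//; case/andP: xI.
have fE j : (j < n)%N -> dyadic_floor (n - j) (2 ^+ j * x) = c%:R / 2 ^+ (n - j).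
  by move=> jn; rewrite /dyadic_floor mulrA -exprD subnK ?cE// ltnW.
rewrite (_ : \sum_(j < n) _ = - ln (\prod_(j < n) (J (c%:R / 2 ^+ (n - j)) *
    r (itinerary partP n x j) (c%:R / 2 ^+ (n - j))))); last first.
  rewrite ln_prod; last by move=> i; exact: mulr_gt0.
  rewrite -sumrN; apply: eq_bigr => j _.
  by rewrite thetaE fE// ffunE.
have p0 (w : {ffun 'I_n -> 'I_k}) (d : nat) : 0 < \prod_(j < n)
    (J (d%:R / 2 ^+ (n - j)) * r (w j) (d%:R / 2 ^+ (n - j))).
  by apply: prodr_gt0 => j _; exact: mulr_gt0.
rewrite lerN2 ler_ln ?posrE ?weight_gt0//.
rewrite /weight big_mkord (bigD1 (Ordinal cn))//= lerDl.
by apply: sumr_ge0 => d _; exact/ltW.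
Qed.

(** Gibbs' inequality with [weight] as reference law; invariance of [mu] then removes the factors
    [2 ^+ j]. *)
Lemma H_join_le_theta n :
  ((H_join mu n P)%:E <= \sum_(j < n) \int[mu]_x (theta (n - j) x)%:E)%E.
Proof.
have mth (j : 'I_n) : measurable_fun setT (fun x : R => theta (n - j) (2 ^+ j * x)).
  by apply: (measurableT_comp (measurable_theta _)); exact: measurable_funM.
apply: (@le_trans _ _
  (\int[mu]_x (\sum_(j < n) theta (n - j) (2 ^+ j * x))%:E)%E).
  apply: (@H_join_le_integral _ _ _ _ muI partP n (@weight n)) => //.
  - exact: weight_gt0.
  - exact: sum_weight.
  - exact: measurable_sum.
  - by move=> x; apply: sumr_ge0 => j _; exact: theta_ge0.
  - exact: ln_weight_le.
under eq_integral do rewrite -sumEFin.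
rewrite ge0_integral_sum//.
- apply: lee_sum => j _.
  rewrite (gibbs_integral_pow2 dJ muI HG j (f := fun x => (theta (n - j) x)%:E))//.
  + by apply/measurable_EFinP; exact: measurable_theta.
  + by move=> x; rewrite theta_periodic.
  + by move=> x; rewrite lee_fin theta_ge0.
- by move=> j; exact/measurable_EFinP.
- by move=> j x _; rewrite lee_fin theta_ge0.
Qed.

End Weights.

(** * Approximation of Borel sets by unions of dyadic cells *)

Section DyadicApproximation.
Context {R : realType} (mu : probability R R).

(** A union of dyadic intervals of length 2^-M. *)
Definition dyadic_at (M : nat) (D : set R) :=
  measurable D /\ forall x, D (dyadic_floor M x) <-> D x.

Definition symdiff (A D : set R) := (A `\` D) `|` (D `\` A).

Definition dyadic_approx (A : set R) := forall e : R, 0 < e ->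
  exists M D, dyadic_at M D /\ (mu (symdiff A D) < e%:E)%E.

Lemma dyadic_at_le M N D : (M <= N)%N -> dyadic_at M D -> dyadic_at N D.
Proof.
move=> MN [mD H]; split => // x.
by rewrite -(H (dyadic_floor N x)) dyadic_floor_comp// H.
Qed.

Lemma measurable_symdiff (A D : set R) :
  measurable A -> measurable D -> measurable (symdiff A D).
Proof. by move=> mA mD; apply: measurableU; exact: measurableD. Qed.

Let mu_sub (A B : set R) : measurable A -> measurable B -> A `<=` B ->
  (mu A <= mu B)%E.
Proof. by move=> mA mB AB; rewrite le_measure ?inE. Qed.

Let mu_subU (A B C : set R) (a b : R) :
  measurable A -> measurable B -> measurable C -> A `<=` B `|` C ->
  (mu B < a%:E)%E -> (mu C < b%:E)%E -> (mu A < (a + b)%:E)%E.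
Proof.
move=> mA mB mC ABC Ba Cb; rewrite EFinD.
apply: (le_lt_trans _ (lteD Ba Cb)).
apply: le_trans (measureU2 _ mB mC); apply: mu_sub => //; exact: measurableU.
Qed.

Lemma dyadic_approxU (A B : set R) : measurable A -> measurable B ->
  dyadic_approx A -> dyadic_approx B -> dyadic_approx (A `|` B).
Proof.
move=> mA mB aA aB e e0; have e2 : 0 < e / 2 by rewrite divr_gt0.
have [M [D [DM AD]]] := aA _ e2; have [N [E [EN BE]]] := aB _ e2.
have [mD HD] := dyadic_at_le (leq_maxl M N) DM.
have [mE HE] := dyadic_at_le (leq_maxr M N) EN.
exists (maxn M N), (D `|` E); split.
  by split; [exact: measurableU|move=> x; rewrite /setU /= HD HE].
rewrite [e]splitr; apply: (mu_subU _ _ _ _ AD BE); try exact: measurable_symdiff.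
  by apply: measurable_symdiff; exact: measurableU.
move=> x [[[Ax|Bx] /not_orP[nD nE]]|[[Dx|Ex] /not_orP[nA nB]]].
- by left; left.
- by right; left.
- by left; right.
- by right; right.
Qed.

(** The approximants lie inside the ray and miss the points above [a] whose dyadic floor is at most
    [a]; these exceptional sets decrease to the empty set as the level grows. *)
Lemma dyadic_approx_ray (a : R) : dyadic_approx `]a, +oo[%classic.
Proof.
move=> e e0.
have mray (b : R) : measurable (`]b, +oo[%classic : set R) by exact: measurable_itv.
pose D M := [set x : R | a < dyadic_floor M x].
have mD M : measurable (D M).
  rewrite -[X in measurable X]setTI.
  have := measurable_dyadic_floor (R := R) M measurableT (mray a).
  by congr measurable; apply/seteqP; split => x /=; rewrite in_itv /= andbT.
pose E M := symdiff `]a, +oo[%classic (D M).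
have mE M : measurable (E M) by exact: measurable_symdiff.
have EE M x : E M x -> dyadic_floor M x <= a < x.
  rewrite /E /symdiff /D /= in_itv /= andbT.
  have /andP[h1 h2] := dyadic_floor_itv M x.
  case=> -[h3 /negP h4]; first by rewrite h3 andbT leNgt.
  by rewrite (lt_le_trans h3 h1) in h4.
have EN M (x : R) : dyadic_floor M x <= a < x -> E M x.
  move=> /andP[h1 h2]; left; split; rewrite /= ?in_itv /= ?h2//.
  by apply/negP; rewrite /D /= -leNgt.
have floor_le M N (x : R) : (M <= N)%N -> dyadic_floor M x <= dyadic_floor N x.
  move=> MN; rewrite -(dyadic_floor_comp x MN).
  by have /andP[] := dyadic_floor_itv M (dyadic_floor N x).
have E0 : \bigcap_M E M = set0.
  apply/seteqP; split => // x H.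
  have /andP[_ ax] := EE _ _ (H 0%N I).
  have xa : 0 < x - a by rewrite subr_gt0.
  near \oo => M.
  have /andP[h1 _] := EE _ _ (H M I).
  have /andP[_ h2] := dyadic_floor_itv M x.
  have h3 : 1 / 2 ^+ M < x - a.
    by near: M; exact: (near_infty_natSinv_expn_lt (PosNum xa)).
  by rewrite div1r in h3; lra.
have C : mu (E M) @[M --> \oo] --> mu (\bigcap_M E M).
  apply: nonincreasing_cvg_mu => //.
  - by rewrite -ge0_fin_numE ?measure_ge0// fin_num_measure.
  - exact: bigcapT_measurable.
  - move=> M N MN; apply/subsetPset => x /EE /andP[h1 h2]; apply: EN.
    by rewrite h2 andbT (le_trans (floor_le _ _ x MN)).
rewrite E0 measure0 in C.
near \oo => M; exists M, (D M); split.
  by split => // x; rewrite /D /= dyadic_floor_comp.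
near: M.
have /fine_cvgP[_ /cvgrPdist_lt /(_ e e0)] := C.
apply: filterS => M; rewrite sub0r normrN ger0_norm ?fine_ge0//= => h.
by rewrite -/(E M) -[mu _]fineK ?lte_fin// fin_num_measure.
Unshelve. all: by end_near. Qed.

(** Approximable sets form a Dynkin class: complements have the same symmetric difference, and a
    countable union is first cut to a finite one by continuity of the measure from above. *)
Lemma measurable_dyadic_approx (A : set R) : measurable A -> dyadic_approx A.
Proof.
have E : @measurable _ R = <<s @RGenOInfty.G R >> by exact: RGenOInfty.measurableE.
rewrite E; move: A.
apply: (@dynkin_induction _ _ (@RGenOInfty.G R)).
- exact: E.
- move=> _ _ [x ->] [y ->]; exists (Num.max x y).
  by apply/seteqP; split => z /=; rewrite !in_itv /= !andbT gt_max;
    [move=> [-> ->]|move=> /andP].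
- move=> e e0; exists 0%N, setT; split; first by split.
  by rewrite /symdiff setDv setU0 measure0.
- by move=> _ [x ->]; exact: dyadic_approx_ray.
- move=> S mS HS e /HS[M [D [[mD HD] SD]]]; exists M, (~` D); split.
    by split; [exact: measurableC|move=> x; rewrite /setC /= HD].
  rewrite (_ : symdiff _ _ = symdiff S D)// /symdiff.
  by rewrite !setDE !setCK setIC setUC [~` D `&` _]setIC.
- move=> F mF _ HF e e0; have e2 : 0 < e / 2 by rewrite divr_gt0.
  pose G n := \bigcup_(k < n) F k.
  have mG n : measurable (G n) by exact: bigcup_measurable.
  have mUF : measurable (\bigcup_k F k) by exact: bigcup_measurable.
  have aG n : dyadic_approx (G n).
    elim: n => [|n IH].
      move=> e' e'0; exists 0%N, set0; split; first by split.
      by rewrite /G bigcup_mkord big_ord0 /symdiff setDv setU0 measure0.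
    rewrite (_ : G n.+1 = G n `|` F n); first exact: dyadic_approxU.
    by rewrite /G !bigcup_mkord big_ord_recr.
  have GU n : G n `<=` \bigcup_k F k by move=> x [k _ Fk]; exists k.
  have C : mu ((\bigcup_k F k) `\` G n) @[n --> \oo] -->
      mu (\bigcap_n ((\bigcup_k F k) `\` G n)).
    apply: nonincreasing_cvg_mu => //.
    - by rewrite -ge0_fin_numE ?measure_ge0// fin_num_measure//; exact: measurableD.
    - by move=> n; exact: measurableD.
    - by apply: bigcapT_measurable => n; exact: measurableD.
    - move=> m n mn; apply/subsetPset => x [Fx nG]; split => //.
      by move=> [k /= km Fk]; apply: nG; exists k => //=; exact: leq_trans mn.
  rewrite (_ : \bigcap_n _ = set0) ?measure0 in C; last first.
    apply/seteqP; split => // x H.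
    have [[k _ Fk] _] := H 0%N I.
    by have [_] := H k.+1 I; apply; exists k => /=.
  have [n Hn] : exists n, (mu ((\bigcup_k F k) `\` G n) < (e / 2)%:E)%E.
    near \oo => n; exists n; near: n.
    have /fine_cvgP[_ /cvgrPdist_lt /(_ _ e2)] := C.
    apply: filterS => n; rewrite sub0r normrN ger0_norm ?fine_ge0//= => h.
    by rewrite -[mu _]fineK ?lte_fin// fin_num_measure//; exact: measurableD.
  have [M [D [[mD HD] GD]]] := aG n _ e2.
  exists M, D; split; first by [].
  rewrite [e]splitr; apply: (mu_subU _ _ _ _ Hn GD).
  - exact: measurable_symdiff.
  - exact: measurableD.
  - exact: measurable_symdiff.
  - move=> x [[Fx nD]|[Dx nF]].
      by have [Gx|nG] := pselect (G n x); [right; left|left].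
    by right; right; split => // /GU.
Unshelve. all: by end_near. Qed.

End DyadicApproximation.

Lemma frac_dyadic_floor {R : realType} m (x : R) :
  frac (dyadic_floor m x) = dyadic_floor m (frac x).
Proof.
have pf : periodic (fun x : R => frac (dyadic_floor m x)).
  by move=> y; rewrite dyadic_floorD1 frac_periodic.
rewrite -(periodic_frac x pf) frac_id//.
have /andP[x0 x1] := frac_I01 x.
have /andP[h _] := dyadic_floor_itv m (frac x).
apply/andP; split; last exact: le_lt_trans x1.
rewrite /dyadic_floor divr_ge0// ?exprn_ge0// ler0z floor_ge0.
by rewrite mulr_ge0// exprn_ge0.
Qed.

(** The lower bound [c] makes ln J uniformly continuous: if [J x] and [J y] differ by at most
    [e * c], then [J x / J y - 1 <= e]. *)
Lemma gdensity_ln_floor {R : realType} (J : R -> R) (e : R) :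
  gdensity J -> 0 < e -> exists M, forall m x, (M <= m)%N ->
    - ln (J (dyadic_floor m x)) <= - ln (J x) + e.
Proof.
move=> dJ e0; have [uJ _ J0 _] := dJ.
have [c [c0 _ Jc]] := gdensity_lbound dJ.
have [d d0 Hd] := uJ (e * c) (mulr_gt0 e0 c0).
near \oo => M; exists M => m x Mm.
have H : (2 ^+ M)^-1 < d.
  rewrite -[X in X < _]mul1r; near: M.
  exact: (near_infty_natSinv_expn_lt (PosNum d0)).
have H' : (2 ^+ m)^-1 <= (2 ^+ M)^-1 :> R.
  by rewrite lef_pV2 ?posrE ?pow2_gt0// ler_eXn2l// ltr1n.
have /andP[h1 h2] := dyadic_floor_itv m x.
have := Hd x (dyadic_floor m x).
rewrite ger0_norm ?subr_ge0// => /(_ _)/ltW; set y := dyadic_floor m x in h1 h2 *.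
have -> : x - y < d by lra.
move=> /(_ isT) Jxy.
have : ln (J x / J y) <= J x / J y - 1 by apply: ln_le_subr1; exact: divr_gt0.
rewrite ln_div ?posrE//.
suff : J x / J y - 1 <= e by lra.
rewrite lerBlDr ler_pdivrMr// mulrDl mul1r.
have /andP[cy _] := Jc y.
have : e * c <= e * J y by rewrite ler_pM2l.
by move: Jxy; rewrite ler_norml; lra.
Unshelve. all: by end_near. Qed.

Lemma measure_bigsetU_le {R : realType} (mu : probability R R) (I : finType)
    (S : I -> set R) (a : I -> R) :
  (forall i, measurable (S i)) -> (forall i, (mu (S i) <= (a i)%:E)%E) ->
  (mu (\big[setU/set0]_i S i) <= (\sum_i a i)%:E)%E.
Proof.
move=> mS Sa.
suff : measurable (\big[setU/set0]_i S i) /\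
  (mu (\big[setU/set0]_i S i) <= (\sum_i a i)%:E)%E by case.
elim/big_rec2: _ => [|i A s _ [mA As]]; first by rewrite measure0; split.
split; first exact: measurableU.
apply: (le_trans (measureU2 _ (mS i) mA)).
by rewrite EFinD; exact: leeD (Sa i) As.
Qed.

Section UpperBound.
Context {R : realType} (J : R -> R) (mu : probability R R).
Hypotheses (dJ : gdensity J) (muI : on_circle mu).
Hypothesis HG : forall phi : R -> R, continuous phi -> periodic phi ->
  (forall x, 0 <= phi x) ->
  (\int[mu]_y (ruelle J phi y)%:E = \int[mu]_y (phi y)%:E)%E.
Variable kap : R.
Hypothesis kapE : (\int[mu]_x (- ln (J x))%:E = kap%:E)%E.

Let lnJ_ge0 x : 0 <= - ln (J x).
Proof.
by case: dJ => _ _ J0 /(_ x) J1; rewrite oppr_ge0 ln_le0//; have := J0 (x + 1 / 2); lra.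
Qed.

Let mlnJ : measurable_fun setT (fun x => - ln (J x)).
Proof.
apply: measurableT_comp => //; apply: (measurableT_comp (@measurable_ln R)).
exact: gdensity_measurable.
Qed.

Let kap_ge0 : 0 <= kap.
Proof. by rewrite -lee_fin -kapE integral_ge0// => x _; rewrite lee_fin. Qed.

Context (k : nat) (P : 'I_k -> set R) (partP : is_partition P).

Let k_gt0 : (0 < k)%N.
Proof. by case: k P partP => // P0 /part_index /(_ 0) []. Qed.

(** The three errors [e] are: evaluating ln J at the dyadic floor, the label where the dyadic sets
    predict it correctly, and the label on the small set where they do not. Levels below [M] are too
    coarse for this, but there are fewer than [M] of them and their cost goes into [C]. *)
Lemma H_join_linear (e : R) : 0 < e ->
  exists C, forall n, H_join mu n P <= C + n%:R * (kap + 3 * e).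
Proof.
move=> e0.
have kR : 0 < k%:R :> R by rewrite ltr0n.
pose ep := e / k%:R; have ep0 : 0 < ep by rewrite divr_gt0.
have kep : k%:R * ep = e by rewrite /ep mulrC divfK// gt_eqF.
(* [rho] will bound every [r i] from below. It involves only [e] and [k], so [L] is fixed before the
   approximating sets are chosen. *)
pose rho := ep / (e + k%:R); have rho0 : 0 < rho by rewrite divr_gt0// addr_gt0.
have rho1 : rho <= 1.
  rewrite ler_pdivrMr ?addr_gt0// mul1r -kep.
  have : 1 <= k%:R :> R by rewrite ler1n.
  nra.
pose L := - ln rho; have L0 : 0 <= L by rewrite oppr_ge0 ln_le0.
have [mP _] := partP.
(* With this accuracy for each of the [k] sets, [Bad] has measure at most [e / (L + 1)], so a cost
   [L] on it amounts to at most [e]. *)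
have e'0 : 0 < e / (k%:R * (L + 1)) by rewrite divr_gt0// mulr_gt0// ltr_wpDl.
have [MD HMD] := choice (fun i => measurable_dyadic_approx mu (mP i) e'0).
have [Df HD] := choice HMD.
have [M0 HM0] := gdensity_ln_floor dJ e0.
pose M := maxn M0 (\max_i MD i).
have DM i : dyadic_at M (Df i).
  have [h _] := HD i; apply: dyadic_at_le h.
  by rewrite (leq_trans _ (leq_maxr _ _))// leq_bigmax.
pose Bad := \big[setU/set0]_i symdiff (P i) (Df i).
have mD i : measurable (Df i) by have [] := DM i.
have mS i : measurable (symdiff (P i) (Df i)) by exact: measurable_symdiff.
have mBad : measurable Bad by apply: bigsetU_measurable.
have BadE : L * fine (mu Bad) <= e.
  have h : (mu Bad <= (\sum_(i < k) e / (k%:R * (L + 1)))%:E)%E.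
    by apply: measure_bigsetU_le => // i; have [_ /ltW] := HD i.
  have -> : e = L * (e / (L + 1)) + e / (L + 1).
    by field; rewrite gt_eqF// ltr_wpDl.
  rewrite -[X in X <= _]addr0 lerD//; last by rewrite divr_ge0 ?ltW// ltr_wpDl.
  rewrite ler_wpM2l// -lee_fin fineK ?fin_num_measure//.
  apply: (le_trans h); rewrite lee_fin sumr_const card_ord -[X in X <= _]mulr_natl.
  rewrite (_ : k%:R * (e / (k%:R * (L + 1))) = e / (L + 1))//; field.
  by rewrite (gt_eqF kR) gt_eqF// ltr_wpDl.
pose g i (x : R) : R := \1_(Df i) (frac x).
have g0 i x : 0 <= g i x by rewrite /g indicE.
have g1 i x : g i x <= 1 by rewrite /g indicE lern1; case: (_ \in _).
pose den x := e + \sum_i g i x.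
have den0 x : 0 < den x by rewrite ltr_pwDl// sumr_ge0.
have denk x : den x <= e + k%:R.
  rewrite lerD2l; apply: (le_trans (ler_sum _ (fun i _ => g1 i x))).
  by rewrite sumr_const card_ord.
(* The predicted label, smoothed so that no label has probability 0. Since [k%:R * ep = e] the total
   is 1, and [r] is constant on dyadic cells of level at least [M]. *)
pose r i x := (ep + g i x) / den x.
have r0 i x : 0 < r i x by rewrite divr_gt0// ltr_pwDl.
have r1 x : \sum_i r i x = 1.
  rewrite -mulr_suml big_split /= sumr_const card_ord -[ep *+ k]mulr_natl kep -/(den x).
  by rewrite divff ?gt_eqF.
have rrho i x : rho <= r i x.
  apply: ler_pM; rewrite ?lerDl ?invr_ge0 ?(ltW ep0) ?(ltW (addr_gt0 e0 kR))//.
  rewrite lef_pV2 ?posrE; [exact: denk|exact: addr_gt0|exact: den0].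
have pg i : periodic (g i) by move=> x; rewrite /g frac_periodic.
have pr i : periodic (r i).
  by move=> x; rewrite /r /den pg; under eq_bigr do rewrite pg.
have mg i : measurable_fun setT (g i).
  exact: (measurableT_comp (measurable_indic (mD i)) measurable_frac).
have mr i : measurable_fun setT (r i).
  apply: measurable_funM; first exact: measurable_funD.
  rewrite (_ : (fun x => _) = (fun x => den x `^ (-1))); last first.
    by apply/funext => x; rewrite powR_inv1// ltW.
  have mden : measurable_fun setT den.
    by apply: measurable_funD => //; exact: measurable_sum.
  exact: (measurableT_comp (measurable_powR (-1)) mden).
have gfl i m x : (M <= m)%N -> g i (dyadic_floor m x) = g i x.
  move=> Mm; rewrite /g !indicE frac_dyadic_floor; congr (_%:R); congr nat_of_bool.
  have [_ h] := dyadic_at_le Mm (DM i).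
  by apply/idP/idP; rewrite !inE h.
have rfl i m x : (M <= m)%N -> r i (dyadic_floor m x) = r i x.
  move=> Mm; rewrite /r /den gfl//; congr (_ / (_ + _)).
  by apply: eq_bigr => j _; rewrite gfl.
have rgood x : ~ Bad (frac x) -> - ln (r (part_index partP x) x) <= e.
  move=> nB; have gE i : g i x = (i == part_index partP x)%:R.
    have nS : ~ symdiff (P i) (Df i) (frac x).
      by move=> S; apply: nB; rewrite /Bad (bigD1 i)//=; left.
    rewrite /g indicE; congr (_%:R); congr nat_of_bool.
    have PiE := part_indexP partP x i.
    apply/idP/eqP => [|/PiE Px]; rewrite inE.
      move=> Dx; apply/PiE; apply: contrapT => nP; apply: nS; by right.
    by apply: contrapT => nD; apply: nS; left.
  (* Off [Bad] exactly one [Df i] contains the point, that of its own label. *)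
  have -> : r (part_index partP x) x = (ep + 1) / (e + 1).
    rewrite /r /den gE eqxx; congr (_ / (_ + _)).
    rewrite (bigD1 (part_index partP x))//= gE eqxx big1 ?addr0// => j /negbTE.
    by rewrite gE => ->.
  rewrite ln_div ?posrE ?addr_gt0//.
  have := ln_le_subr1 (_ : 0 < e + 1); rewrite addrK => /(_ (addr_gt0 e0 ltr01)).
  have : 0 <= ln (ep + 1) by rewrite ln_ge0// lerDr ltW.
  by lra.
have [c [c0 _ Jc]] := gdensity_lbound dJ.
pose th := theta J P r.
pose B := fun m => kap + 3 * e + (if (m < M)%N then - ln c + L else 0).
have thL m x : th m x <= - ln c + L.
  rewrite /th (thetaE _ _ partP) lnM ?posrE//; last by case: dJ.
  rewrite opprD lerD// lerN2 ler_ln ?posrE//; last by case: dJ.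
  by have /andP[] := Jc (dyadic_floor m x).
have thB m x : (M <= m)%N -> th m x <= - ln (J x) + (e + e) + L * \1_Bad (frac x).
  move=> Mm; rewrite /th (thetaE _ _ partP) lnM ?posrE//; last by case: dJ.
  have h1 := HM0 m x (leq_trans (leq_maxl _ _) Mm).
  rewrite rfl// indicE.
  have [/set_mem bx|/negP bx] := boolP (frac x \in Bad); rewrite /= ?mulr1n ?mulr0n.
    have : - ln (r (part_index partP x) x) <= L by rewrite lerN2 ler_ln ?posrE.
    by lra.
  have := rgood x; rewrite in_setE in bx => /(_ bx); lra.
have mI : measurable_fun setT (fun x => (\1_Bad (frac x))%:E : \bar R).
  apply/measurable_EFinP.
  exact: (measurableT_comp (measurable_indic mBad) measurable_frac).
have mLI : measurable_fun setT
    (fun x => (cst (e + e)%:E x + L%:E * (\1_Bad (frac x))%:E)%E).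
  apply: emeasurable_funD; first exact: measurable_cst.
  by apply: emeasurable_funM; first exact: measurable_cst.
have muT : mu setT = 1%E by exact: probability_setT.
have thI m : (\int[mu]_x (th m x)%:E <= (B m)%:E)%E.
  rewrite /B; case: ltnP => mM.
    apply: (@le_trans _ _ (\int[mu]_x (cst (- ln c + L)%:E x))%E).
      apply: ge0_le_integral => //.
      - by move=> x _; rewrite lee_fin; apply: theta_ge0.
      - by apply/measurable_EFinP; apply: measurable_theta.
      - by move=> x _; rewrite lee_fin.
    rewrite integral_cst// [X in (_ * X)%E]muT mule1 lee_fin lerDr.
    by rewrite addr_ge0// mulr_ge0// ltW.
  apply: (@le_trans _ _ (\int[mu]_x ((- ln (J x))%:E + (cst (e + e)%:E x +
      L%:E * (\1_Bad (frac x))%:E)))%E).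
    apply: ge0_le_integral => //.
    - by move=> x _; rewrite lee_fin; apply: theta_ge0.
    - by apply/measurable_EFinP; apply: measurable_theta.
    - by apply: emeasurable_funD; first exact/measurable_EFinP.
    - by move=> x _; rewrite -EFinM -!EFinD lee_fin addrA thB.
  rewrite ge0_integralD//; last 3 first.
  - by move=> x _; rewrite lee_fin.
  - exact/measurable_EFinP.
  - move=> x _; apply: adde_ge0; first by rewrite lee_fin addr_ge0// ltW.
    by apply: mule_ge0; rewrite lee_fin.
  rewrite ge0_integralD//; last 3 first.
  - by move=> x _; rewrite lee_fin addr_ge0// ltW.
  - by move=> x _; apply: mule_ge0; rewrite lee_fin.
  - by apply: emeasurable_funM; first exact: measurable_cst.
  rewrite ge0_integralZl_EFin//.
  rewrite kapE integral_cst// [X in (_ * X)%E]muT mule1.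
  have -> : (\int[mu]_x (\1_Bad (frac x))%:E)%E = mu Bad.
    exact: circle_integral_indic.
  rewrite -[mu Bad]fineK ?fin_num_measure// -EFinM -!EFinD lee_fin; lra.
exists (M%:R * (- ln c + L)) => n.
have := H_join_le_theta dJ muI partP HG r0 r1 pr mr n.
have cL : 0 <= - ln c + L by apply: le_trans (thL 0%N 0); exact: theta_ge0.
move=> /le_trans H; rewrite -lee_fin; apply: H.
apply: (@le_trans _ _ (\sum_(j < n) (B (n - j)%N)%:E)%E).
  by apply: lee_sum => j _; exact: thI.
(* In reversed time the levels run from 1 to [n], and at most [minn n M] of them pay the
   surcharge. *)
rewrite sumEFin lee_fin (reindex_inj rev_ord_inj) /= /B big_split /=.
rewrite sumr_const card_ord -[(_ + _) *+ n]mulr_natl addrC lerD2r.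
have -> : \sum_(i < n) (if (n - (n - i.+1) < M)%N then - ln c + L else 0) =
    \sum_(i < n) (if (i.+1 < M)%N then - ln c + L else 0).
  by apply: eq_bigr => i _; rewrite subKn.
apply: (@le_trans _ _ ((minn n M)%:R * (- ln c + L))); last first.
  by rewrite ler_wpM2r// ler_nat geq_minr.
elim: n => [|n IH]; first by rewrite big_ord0 min0n mul0r.
rewrite big_ord_recr /=; case: ltnP => nM.
  apply: (le_trans (lerD IH (lexx _))).
  rewrite -[X in _ + X <= _]mul1r -mulrDl ler_wpM2r// natr1 ler_nat.
  by lia.
by rewrite addr0; apply: (le_trans IH); rewrite ler_wpM2r// ler_nat; lia.
Qed.

Lemma h_part_le : h_part mu P <= kap.
Proof.
(* Three quarters of [e] go into the linear rate, the last one absorbs [C / n]. *)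
apply/ler_addgt0Pr => e e0; have e4 : 0 < e / 4 by rewrite divr_gt0.
(* If [u] diverges, [limn] is the default value 0, and [kap] is nonnegative. *)
rewrite /h_part; set u := fun n => _.
have [cu|/dvgP ->] := pselect (cvgn u); last first.
  by rewrite (le_trans kap_ge0)// lerDl ltW.
have [C HC] := H_join_linear e4.
apply: limr_le => //; near=> n.
have n0 : 0 < n%:R :> R by rewrite ltr0n; near: n; exists 1%N.
rewrite /u ler_pdivrMr//; apply: (le_trans (HC n)).
have : C <= n%:R * (e / 4).
  rewrite -ler_pdivrMr//.
  by near: n; exact: nbhs_infty_ger.
by rewrite mulrDl mulrDr; lra.
Unshelve. all: by end_near. Qed.

End UpperBound.

(** * Lower bound for the entropy of an invariant measure *)

Section BinaryEntropy.
Context {R : realType}.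
Implicit Types a b p q : R.

Definition binary_entropy p := eta p + eta (1 - p).

(** For [a + b > 0] this is [a + b] times the binary entropy of [a / (a + b)]: the entropy gained by
    splitting a mass in two. *)
Definition entropy_defect a b := eta a + eta b - eta (a + b).

Lemma entropy_defect_le a b q : 0 <= a -> 0 <= b -> 0 < q < 1 ->
  entropy_defect a b <= - ln q * a + - ln (1 - q) * b.
Proof.
move=> a0 b0 /andP[q0 q1]; have q1' : 0 < 1 - q by rewrite subr_gt0.
have [s0|s0] := eqVneq (a + b) 0.
  have [-> ->] : a = 0 /\ b = 0 by lra.
  by rewrite /entropy_defect /Defs.eta addr0 eqxx !mulr0; lra.
have s1 : 0 < a + b by rewrite lt_neqAle eq_sym s0 addr_ge0.
have h1 := eta_le a0 (mulr_gt0 q0 s1).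
have h2 := eta_le b0 (mulr_gt0 q1' s1).
rewrite /entropy_defect [eta (a + b)]/Defs.eta (negbTE s0).
rewrite !lnM ?posrE// in h1 h2.
have := lerD h1 h2; lra.
Qed.

Lemma entropy_defectE a b : 0 < a -> 0 < b ->
  entropy_defect a b = - ln (a / (a + b)) * a + - ln (1 - a / (a + b)) * b.
Proof.
move=> a0 b0; have s0 : 0 < a + b by exact: addr_gt0.
have -> : 1 - a / (a + b) = b / (a + b) by field; rewrite gt_eqF.
rewrite !ln_div ?posrE// /entropy_defect /Defs.eta !gt_eqF//; lra.
Qed.

Lemma entropy_defect0l a : entropy_defect 0 a = 0.
Proof. by rewrite /entropy_defect add0r {1}/Defs.eta eqxx add0r subrr. Qed.

Lemma entropy_defectC a b : entropy_defect a b = entropy_defect b a.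
Proof. by rewrite /entropy_defect [a + b]addrC [eta a + _]addrC. Qed.

(** For positive arguments the defect is the minimum over [q] of linear forms in [(a, b)], hence
    superadditive: [q] is taken optimal for the totals and used in every term. If a total vanishes,
    that [q] would be 0 or 1, but then all terms are 0. *)
Lemma entropy_defect_sup (I : finType) (a b : I -> R) :
  (forall i, 0 <= a i) -> (forall i, 0 <= b i) ->
  \sum_i entropy_defect (a i) (b i) <= entropy_defect (\sum_i a i) (\sum_i b i).
Proof.
move=> a0 b0; have A0 : 0 <= \sum_i a i by exact: sumr_ge0.
have B0 : 0 <= \sum_i b i by exact: sumr_ge0.
have [A1|A1] := eqVneq (\sum_i a i) 0.
  rewrite A1 entropy_defect0l big1// => i _.
  move/eqP: A1; rewrite psumr_eq0// => /allP/(_ i); rewrite mem_index_enum.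
  by move=> /(_ isT)/eqP ->; exact: entropy_defect0l.
have [B1|B1] := eqVneq (\sum_i b i) 0.
  rewrite B1 entropy_defectC entropy_defect0l big1// => i _.
  move/eqP: B1; rewrite psumr_eq0// => /allP/(_ i); rewrite mem_index_enum.
  by move=> /(_ isT)/eqP ->; rewrite entropy_defectC; exact: entropy_defect0l.
have A2 : 0 < \sum_i a i by rewrite lt_neqAle eq_sym A1.
have B2 : 0 < \sum_i b i by rewrite lt_neqAle eq_sym B1.
rewrite entropy_defectE//; set q := _ / _.
have q01 : 0 < q < 1.
  by rewrite divr_gt0 ?addr_gt0//= ltr_pdivrMr ?addr_gt0// mul1r ltrDl.
rewrite !mulr_sumr -big_split; apply: ler_sum => i _.
exact: entropy_defect_le.
Qed.

Lemma binary_entropy_le p q : 0 <= p <= 1 -> 0 < q < 1 ->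
  binary_entropy p <= - ln q * p + - ln (1 - q) * (1 - p).
Proof.
move=> /andP[p0 p1] /andP[q0 q1].
have p1' : 0 <= 1 - p by rewrite subr_ge0.
have q1' : 0 < 1 - q by rewrite subr_gt0.
have := lerD (eta_le p0 q0) (eta_le p1' q1').
by rewrite /binary_entropy; lra.
Qed.

Lemma binary_entropy_ge0 p : 0 <= p <= 1 -> 0 <= binary_entropy p.
Proof. by move=> p01; rewrite addr_ge0// eta_ge0//; lra. Qed.

Lemma binary_entropyE p : 0 < p < 1 ->
  binary_entropy p = - ln p * p + - ln (1 - p) * (1 - p).
Proof.
move=> /andP[p0 p1]; rewrite /binary_entropy /Defs.eta !gt_eqF ?subr_gt0//.
by rewrite !mulNr ![ln _ * _]mulrC.
Qed.

Lemma binary_entropy1B p : binary_entropy (1 - p) = binary_entropy p.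
Proof. by rewrite /binary_entropy addrC subKr. Qed.

End BinaryEntropy.

Section WordSplit.
Context (I : finType) (n : nat) (h : 'I_n.+1).

(** Used at both ends: [ord0] adds a label for the present in front of a word read from T x,
    [ord_max] refines a cell by one later label. *)
Definition insert_letter (i : I) (w : {ffun 'I_n -> I}) : {ffun 'I_n.+1 -> I} :=
  [ffun j => if unlift h j is Some j' then w j' else i].

Lemma insert_letter_at i w : insert_letter i w h = i.
Proof. by rewrite ffunE unlift_none. Qed.

Lemma insert_letter_lift i w j : insert_letter i w (lift h j) = w j.
Proof. by rewrite ffunE liftK. Qed.

Lemma sum_insert_letter (V : nmodType) (F : {ffun 'I_n.+1 -> I} -> V) :
  \sum_w F w = \sum_w \sum_i F (insert_letter i w).
Proof.
rewrite pair_big /= (reindex (fun p : {ffun 'I_n -> I} * I => insert_letter p.2 p.1))//=.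
exists (fun w => ([ffun j => w (lift h j)], w h)) => [[w i] _|w _] /=.
  rewrite insert_letter_at; congr pair.
  by apply/ffunP => j; rewrite ffunE insert_letter_lift.
apply/ffunP => j; rewrite ffunE; case: unliftP => [j' ->|->//].
by rewrite ffunE.
Qed.

End WordSplit.

Section LowerBound.
Context {R : realType} (nu : probability R R).
Hypotheses (nuI : on_circle nu).
Hypothesis nuT : forall A, measurable A -> nu [set x | A (frac (2 * x))] = nu A.
Context (k : nat) (P : 'I_k -> set R) (partP : is_partition P).

Definition branch (i : 'I_k) (A : set R) : R :=
  fine (nu [set x | P i (frac x) /\ A (frac (2 * x))]).

Let mT (A : set R) : measurable A -> measurable [set x : R | A (frac (2 * x))].
Proof.
move=> mA; rewrite -[X in measurable X]setTI.
by apply: (measurableT_comp measurable_frac) => //; exact: measurable_funM.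
Qed.

Let mP i : measurable (P i). Proof. by case: partP. Qed.

Let mPT i (A : set R) : measurable A ->
  measurable [set x : R | P i (frac x) /\ A (frac (2 * x))].
Proof.
move=> mA.
suff mPi : measurable [set x : R | P i (frac x)] by exact: measurableI mPi (mT mA).
by rewrite -[X in measurable X]setTI; apply: measurable_frac => //; exact: mP.
Qed.

Lemma measure_part (f : R -> R) (B : set R) : measurable_fun setT f ->
  measurable B ->
  fine (nu B) = \sum_i fine (nu (B `&` [set x | P i (frac (f x))])).
Proof.
move=> mf mB.
have mi i : measurable (B `&` [set x | P i (frac (f x))]).
  apply: measurableI => //; rewrite -[X in measurable X]setTI.
  by apply: (measurableT_comp measurable_frac mf) => //; exact: mP.
apply: EFin_inj; rewrite fineK ?fin_num_measure// -sumEFin.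
transitivity (\int[nu]_x (\sum_i (\1_(B `&` [set x | P i (frac (f x))]) x)%:E))%E.
  rewrite -[X in nu X]setIT -integral_indic//; apply: eq_integral => x _.
  rewrite sumEFin; congr EFin; rewrite (bigD1 (part_index partP (f x)))//= big1.
    rewrite addr0 !indicE in_setI [X in _ && X]mem_set ?andbT//=.
    exact/part_indexP.
  move=> i ne; rewrite indicE memNset// => -[_ /(part_indexP partP) E].
  by rewrite E eqxx in ne.
rewrite ge0_integral_sum//; last first.
  by move=> i; apply/measurable_EFinP; exact: measurable_indic.
apply: eq_bigr => i _; rewrite integral_indic// setIT fineK//.
exact: fin_num_measure.
Qed.

Lemma join_cell_first n i (w : {ffun 'I_n -> 'I_k}) :
  fine (nu (join_cell P (insert_letter ord0 i w))) = branch i (join_cell P w).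
Proof.
rewrite /branch -(circle_measureI nuI (mPT i (measurable_join_cell partP w))).
congr (fine (nu _)); apply/seteqP; split => x.
  move=> [xI H]; split => //; split.
    by have := H ord0; rewrite insert_letter_at /= frac_id.
  split; first exact: frac_I01.
  by move=> j; have := H (lift ord0 j); rewrite insert_letter_lift /= -iterSr.
move=> [[Pix [_ H]] xI]; split => // j.
case: (unliftP ord0 j) => [j' ->|->].
  by rewrite insert_letter_lift /= -iterS iterSr; exact: H.
by rewrite insert_letter_at /=; rewrite frac_id in Pix.
Qed.

Lemma branch_ge0 i A : 0 <= branch i A.
Proof. exact: fine_ge0. Qed.

Lemma measure_branch A : measurable A -> fine (nu A) = \sum_i branch i A.
Proof.
move=> mA; rewrite -(nuT mA) (@measure_part id)//; last exact: mT.
by apply: eq_bigr => i _; rewrite /branch setIC.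
Qed.

(** The word [w] is read along T x, so the appended label is that of [x] at time n + 1, whence the
    point [2 ^+ n * (2 * x)]. *)
Lemma branch_last n i (w : {ffun 'I_n -> 'I_k}) :
  branch i (join_cell P w) =
  \sum_j branch i (join_cell P (insert_letter ord_max j w)).
Proof.
rewrite {1}/branch (@measure_part (fun x => 2 ^+ n * (2 * x))).
- apply: eq_bigr => j _; congr (fine (nu _)).
  have E x : iter n (@dbl R) (frac (2 * x)) = frac (2 ^+ n * (2 * x)).
    rewrite iter_dbl; last exact: frac_I01.
    exact: (periodic_frac _ (periodic_pow2 n frac_periodic)).
  apply/seteqP; split => x /=.
    move=> [[Pi [xI H]] Pj]; split => //; split => // m.
    case: (unliftP ord_max m) => [m' ->|->].
      by rewrite insert_letter_lift lift_max; exact: H.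
    by rewrite insert_letter_at /= E.
  move=> [Pi [xI H]]; split; last first.
    by have := H ord_max; rewrite insert_letter_at /= E.
  split => //; split => // m; have := H (lift ord_max m).
  by rewrite insert_letter_lift lift_max.
- by apply: measurable_funM => //; exact: measurable_funM.
- exact: (mPT i (measurable_join_cell partP w)).
Qed.

Lemma H_joinS n : H_join nu n.+1 P =
  \sum_(w : {ffun 'I_n -> 'I_k}) \sum_i eta (branch i (join_cell P w)).
Proof.
rewrite /H_join (sum_insert_letter ord0); apply: eq_bigr => w _.
by apply: eq_bigr => i _; rewrite join_cell_first.
Qed.

End LowerBound.

(** * Entropy of the partition by the first binary digit *)

Section HalfPartition.
Context {R : realType}.

Definition half (i : 'I_2) : set R :=
  if i == ord0 then [set x | 0 <= x < 1 / 2] else [set x | 1 / 2 <= x < 1].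

Lemma half_partition : is_partition half.
Proof.
split; [|split; [|split]] => [i|i|i j|x].
- rewrite /half; case: ifP => _.
    rewrite (_ : [set x | _] = `[0, 1 / 2[%classic); first exact: measurable_itv.
    by apply/seteqP; split => x /=; rewrite in_itv.
  rewrite (_ : [set x | _] = `[1 / 2, 1[%classic); first exact: measurable_itv.
  by apply/seteqP; split => x /=; rewrite in_itv.
- by rewrite /half; case: ifP => _ x; rewrite /I01 /=; lra.
- have : (i = ord0 \/ i = ord_max) /\ (j = ord0 \/ j = ord_max).
    by split; [case: i => -[|[|]]//= ?; [left|right]|case: j => -[|[|]]//= ?; [left|right]];
      exact/val_inj.
  case=> -[]-> []-> //= _; apply/seteqP; split => // x; rewrite /half /=; lra.
- rewrite /I01 /= => xI; have [x2|x2] := ltP x (1 / 2).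
    by exists ord0; rewrite /half /=; lra.
  by exists ord_max; rewrite /half /=; lra.
Qed.

Context (nu : probability R R).
Hypotheses (nuI : on_circle nu).
Hypothesis nuT : forall A, measurable A -> nu [set x | A (frac (2 * x))] = nu A.

Let br (i : 'I_2) (A : set R) := branch nu half i A.

(** The conditional entropy of the first digit given the next [n] digits. *)
Let d n := \sum_(w : {ffun 'I_n -> 'I_2})
  entropy_defect (br ord0 (join_cell half w)) (br ord_max (join_cell half w)).

Let measure_br A : measurable A -> fine (nu A) = br ord0 A + br ord_max A.
Proof.
move=> mA; rewrite (measure_branch nuT half_partition)// big_ord_recl big_ord1.
by congr (_ + br _ _); exact/val_inj.
Qed.

Let H_S n : H_join nu n.+1 half = H_join nu n half + d n.
Proof.
rewrite (H_joinS nuI half_partition) /H_join /d -big_split /=.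
apply: eq_bigr => w _; rewrite big_ord_recl big_ord1.
rewrite measure_br; last exact: (measurable_join_cell half_partition).
by rewrite /entropy_defect addrC subrK; congr (_ + eta (branch _ _ _ _)); exact/val_inj.
Qed.

Let H_0 : H_join nu 0 half = 0.
Proof.
rewrite /H_join; have := sum_measure_join_cell nuI half_partition 0.
rewrite (big_pred1 [ffun=> ord0]) => [E|w]; last first.
  by apply/esym/eqP/ffunP => -[].
rewrite (big_pred1 [ffun=> ord0]) => [|w]; last first.
  by apply/esym/eqP/ffunP => -[].
by rewrite E /Defs.eta oner_eq0 ln1 mulr0 oppr0.
Qed.

Let H_series n : H_join nu n half = series d n.
Proof.
elim: n => [|n IH]; first by rewrite H_0 /series /= big_nil.
by rewrite H_S IH /series /= big_nat_recr.
Qed.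

(** One more known digit splits each cell in two, and by superadditivity of the defect the total can
    only decrease. *)
Let d_noninc : nonincreasing_seq d.
Proof.
apply/nonincreasing_seqP => n.
rewrite /d (sum_insert_letter ord_max); apply: ler_sum => w _.
rewrite [in leRHS]/br !(branch_last nu half_partition _ w).
by apply: entropy_defect_sup => i; exact: branch_ge0.
Qed.

(** The sequence [d] decreases and is bounded below by [kap], so it converges;
    [H_join nu n half / n] is its Cesàro mean and has the same limit. *)
Lemma h_part_ge (kap : R) : (forall n, kap <= \sum_(w : {ffun 'I_n -> 'I_2})
    entropy_defect (br ord0 (join_cell half w)) (br ord_max (join_cell half w))) ->
  kap <= h_part nu half.
Proof.
move=> Hd.
have cd : cvgn d.
  by apply: nonincreasing_is_cvgn => //; exists kap => _ [n _ <-]; exact: Hd.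
have kl : kap <= limn d by apply: limr_ge => //; exact: nearW.
suff : (fun n => H_join nu n half / n%:R) @ \oo --> limn d.
  by move=> /cvg_lim; rewrite /h_part => ->.
(* [arithmetic_mean] averages n + 1 terms at index [n]; the shift aligns the two and discards the
   division by 0. *)
rewrite -cvg_shiftS /=.
have := cesaro cd; apply: cvg_trans; apply: near_eq_cvg; apply: nearW => n.
by rewrite /arithmetic_mean /= H_series mulrC.
Qed.

End HalfPartition.

(** * Conditional entropy bounded below by an integral of binary entropies *)

Section DefectIntegral.
Context {R : realType} (nu : probability R R).
Hypotheses (nuI : on_circle nu).
Context {disp} {T : measurableType disp} (M : {measure set T -> \bar R}).
Context (W p : T -> R) (c : R).
Hypotheses (mW : measurable_fun setT W) (mp : measurable_fun setT p).
Hypothesis WI : forall t, I01 (W t).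
Hypotheses (c0 : 0 < c) (pc : forall t, c <= p t <= 1 - c).
Hypothesis br0 : forall A, measurable A ->
  ((branch nu half ord0 A)%:E = \int[M]_t (p t * \1_A (W t))%:E)%E.
Hypothesis br1 : forall A, measurable A ->
  ((branch nu half ord_max A)%:E = \int[M]_t ((1 - p t) * \1_A (W t))%:E)%E.

Let mI (A : set R) : measurable A -> measurable_fun setT (fun t => \1_A (W t) : R).
Proof. by move=> mA; exact: (measurableT_comp (measurable_indic mA) mW). Qed.

Let I0 (A : set R) t : 0 <= \1_A (W t) :> R. Proof. by rewrite indicE. Qed.

Let p01 t : 0 < p t < 1.
Proof.
have /andP[h1 h2] := pc t; apply/andP; split; first exact: lt_le_trans h1.
by apply: (le_lt_trans h2); rewrite ltrBlDr ltrDl.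
Qed.

Let mh : measurable_fun setT (fun t => binary_entropy (p t)).
Proof.
rewrite (_ : (fun t => _) = fun t => - ln (p t) * p t + - ln (1 - p t) * (1 - p t)).
  have m1 : measurable_fun setT (fun t => 1 - p t) by exact: measurable_funB.
  by apply: measurable_funD; apply: measurable_funM => //;
    apply: measurableT_comp => //; apply: (measurableT_comp (@measurable_ln R)).
by apply/funext => t; rewrite binary_entropyE ?p01.
Qed.

Let h0 t : 0 <= binary_entropy (p t).
Proof. by apply: binary_entropy_ge0; have /andP[/ltW -> /ltW ->] := p01 t. Qed.

(** Here [p t] is the probability of digit 0 given finer information [t], and [W t] the doubled
    point. Concavity is used through one tangent line, at the mean [a / (a + b)] of [p] over [A],
    where integration gives back the defect exactly. *)
Lemma binary_entropy_cell A : measurable A ->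
  (\int[M]_t (binary_entropy (p t) * \1_A (W t))%:E <=
   (entropy_defect (branch nu half ord0 A) (branch nu half ord_max A))%:E)%E.
Proof.
move=> mA; have A0 := br0 mA; have A1 := br1 mA.
set a := branch nu half ord0 A in A0 *; set b := branch nu half ord_max A in A1 *.
have m1 : measurable_fun setT (fun t => 1 - p t) by exact: measurable_funB.
have p0 t : 0 <= p t by have := p01 t; lra.
have p1 t : 0 <= 1 - p t by have := p01 t; lra.
have mpA : measurable_fun setT (fun t => (p t * \1_A (W t))%:E : \bar R).
  by apply/measurable_EFinP; apply: measurable_funM => //; exact: mI.
have mp1A : measurable_fun setT (fun t => ((1 - p t) * \1_A (W t))%:E : \bar R).
  by apply/measurable_EFinP; apply: measurable_funM => //; exact: mI.
have key (s q : R) : 0 <= s -> 0 <= q ->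
    (forall t, binary_entropy (p t) <= s * p t + q * (1 - p t)) ->
    (\int[M]_t (binary_entropy (p t) * \1_A (W t))%:E <= (s * a + q * b)%:E)%E.
  move=> s0 q0 H.
  rewrite EFinD !EFinM A0 A1 -!ge0_integralZl_EFin//; last 2 first.
  - by move=> t _; rewrite lee_fin mulr_ge0.
  - by move=> t _; rewrite lee_fin mulr_ge0.
  rewrite -ge0_integralD//; last 4 first.
  - by move=> t _; rewrite -EFinM lee_fin !mulr_ge0.
  - by apply: emeasurable_funM => //; exact: measurable_cst.
  - by move=> t _; rewrite -EFinM lee_fin !mulr_ge0.
  - by apply: emeasurable_funM => //; exact: measurable_cst.
  apply: ge0_le_integral => //.
  - by move=> t _; rewrite lee_fin mulr_ge0.
  - by apply/measurable_EFinP; apply: measurable_funM => //; exact: mI.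
  - by apply: emeasurable_funD; apply: emeasurable_funM => //; exact: measurable_cst.
  - move=> t _; rewrite -!EFinM -EFinD lee_fin !mulrA -mulrDl.
    by rewrite ler_wpM2r.
have a0 : 0 <= a by exact: fine_ge0.
have b0 : 0 <= b by exact: fine_ge0.
(* As [p] stays away from 0 and 1, [a] and [b] vanish together; otherwise the mean lies strictly
   between 0 and 1 and the tangent exists. *)
have ca : c * b <= a.
  rewrite -lee_fin EFinM A0 A1 -ge0_integralZl_EFin ?(ltW c0)//; last first.
    by move=> t _; rewrite lee_fin mulr_ge0.
  apply: ge0_le_integral => //.
  - by move=> t _; rewrite -EFinM lee_fin !mulr_ge0// ltW.
  - by apply: emeasurable_funM => //; exact: measurable_cst.
  - move=> t _; rewrite -EFinM lee_fin mulrA ler_wpM2r//.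
    have := pc t; have := p01 t; nra.
have cb : c * a <= b.
  rewrite -lee_fin EFinM A0 A1 -ge0_integralZl_EFin ?(ltW c0)//; last first.
    by move=> t _; rewrite lee_fin mulr_ge0.
  apply: ge0_le_integral => //.
  - by move=> t _; rewrite -EFinM lee_fin !mulr_ge0// ltW.
  - by apply: emeasurable_funM => //; exact: measurable_cst.
  - move=> t _; rewrite -EFinM lee_fin mulrA ler_wpM2r//.
    have := pc t; have := p01 t; nra.
(* In the null case the constant majorant [- ln c] replaces the tangent and bounds the integral by
   0. *)
have [aE|a1] := eqVneq a 0.
  have bE : b = 0.
    by apply/eqP; rewrite eq_le b0 andbT -(pmulr_rle0 _ c0) (le_trans ca)// aE.
  rewrite aE bE entropy_defect0l.
  have := key (- ln c) (- ln c); rewrite aE bE !mulr0 addr0; apply.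
  - by rewrite oppr_ge0 ln_le0//; have := pc point; have := p01 point; lra.
  - by rewrite oppr_ge0 ln_le0//; have := pc point; have := p01 point; lra.
  - move=> t; rewrite -mulrDr addrC subrK mulr1 binary_entropyE; last by have := p01 t; lra.
    have h1 : ln c <= ln (p t) by rewrite ler_ln ?posrE//; have := p01 t; have := pc t; lra.
    have h2 : ln c <= ln (1 - p t) by rewrite ler_ln ?posrE//; have := p01 t; have := pc t; lra.
    by have := p0 t; have := p1 t; nra.
have a2 : 0 < a by rewrite lt_neqAle eq_sym a1.
have b2 : 0 < b by apply: lt_le_trans cb; exact: mulr_gt0.
have q01 : 0 < a / (a + b) < 1.
  by rewrite divr_gt0 ?addr_gt0//= ltr_pdivrMr ?addr_gt0// mul1r ltrDl.
rewrite entropy_defectE//; apply: key.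
- by rewrite oppr_ge0 ln_le0//; lra.
- by rewrite oppr_ge0 ln_le0//; lra.
- by move=> t; apply: binary_entropy_le => //; have := p01 t; have := pc t; lra.
Qed.

Lemma binary_entropy_defect n (kap : R) :
  (kap%:E <= \int[M]_t (binary_entropy (p t))%:E)%E ->
  kap <= \sum_(w : {ffun 'I_n -> 'I_2})
    entropy_defect (branch nu half ord0 (join_cell half w))
      (branch nu half ord_max (join_cell half w)).
Proof.
move=> Hk; rewrite -lee_fin; apply: (le_trans Hk); rewrite -sumEFin.
have mw (w : {ffun 'I_n -> 'I_2}) := measurable_join_cell (@half_partition R) w.
rewrite [leLHS](_ : _ = (\sum_(w : {ffun 'I_n -> 'I_2})
    \int[M]_t (binary_entropy (p t) * \1_(join_cell half w) (W t))%:E)%E).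
  by apply: lee_sum => w _; exact: binary_entropy_cell.
rewrite -ge0_integral_sum//.
- apply: eq_integral => t _; rewrite sumEFin; congr EFin.
  by rewrite (sum_join_cell (@half_partition R) (fun=> binary_entropy (p t))).
- by move=> w; apply/measurable_EFinP; apply: measurable_funM => //; exact: mI.
- by move=> w t _; rewrite lee_fin mulr_ge0.
Qed.

End DefectIntegral.

(** * The convolution *)

Lemma gibbs_split_shift {R : realType} (J : R -> R) (mu : probability R R)
    (B : set R) (a : R) :
  (forall A, measurable A -> (\int[mu]_x
    (J x * \1_A (frac x) + (1 - J x) * \1_A (frac (x + 1 / 2)))%:E = mu A)%E) ->
  on_circle mu -> measurable B ->
  (\int[mu]_x (\1_B (frac (a + x)))%:E =
   \int[mu]_x (J x * \1_B (frac (a + x)) +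
     (1 - J x) * \1_B (frac (a + x + 1 / 2)))%:E)%E.
Proof.
move=> HJ muI mB; pose A := [set x | B (frac (a + x))].
have mA : measurable A.
  rewrite -[X in measurable X]setTI.
  by apply: (measurableT_comp measurable_frac) => //; exact: measurable_funD.
have pA : periodic (fun x => \1_B (frac (a + x)) : R).
  by move=> x; rewrite addrA frac_periodic.
have E x : \1_A (frac x) = \1_B (frac (a + x)) :> R.
  by rewrite -(periodic_frac x pA) !indicE.
transitivity (mu A).
  rewrite -(circle_integral_indic muI mA).
  by apply: eq_integral => x _; rewrite E.
rewrite -HJ//; apply: eq_integral => x _.
by rewrite !E addrA.
Qed.

Section Convolution.
Context {R : realType} (J1 J2 : R -> R) (mu1 mu2 nu : probability R R).
Hypotheses (d1 : gdensity J1) (d2 : gdensity J2).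
Hypotheses (I1 : on_circle mu1) (I2 : on_circle mu2).
Hypothesis split1 : forall A, measurable A -> (\int[mu1]_x
  (J1 x * \1_A (frac x) + (1 - J1 x) * \1_A (frac (x + 1 / 2)))%:E = mu1 A)%E.
Hypothesis split2 : forall A, measurable A -> (\int[mu2]_x
  (J2 x * \1_A (frac x) + (1 - J2 x) * \1_A (frac (x + 1 / 2)))%:E = mu2 A)%E.
Hypothesis double1 : forall f : R -> \bar R, measurable_fun setT f ->
  periodic f -> (forall x, 0 <= f x)%E ->
  (\int[mu1]_x f (2 * x)%R = \int[mu1]_x f x)%E.
Hypothesis double2 : forall f : R -> \bar R, measurable_fun setT f ->
  periodic f -> (forall x, 0 <= f x)%E ->
  (\int[mu2]_x f (2 * x)%R = \int[mu2]_x f x)%E.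
Hypothesis conv : convolution_of mu1 mu2 nu.

Let M : {measure set (R * R) -> \bar R} := (mu1 \x mu2)%E.

Let msum : measurable_fun setT (fun z : R * R => z.1 + z.2).
Proof. exact: measurable_funD. Qed.

Let mfs (a : R) : measurable_fun setT (fun z : R * R => frac (z.1 + z.2 + a)).
Proof.
apply: (measurableT_comp measurable_frac); exact: measurable_funD.
Qed.

Let mind (B : set R) a : measurable B ->
  measurable_fun setT (fun z : R * R => \1_B (frac (z.1 + z.2 + a)) : R).
Proof. by move=> mB; exact: (measurableT_comp (measurable_indic mB) (mfs a)). Qed.

Let mind0 (B : set R) : measurable B ->
  measurable_fun setT (fun z : R * R => \1_B (frac (z.1 + z.2)) : R).
Proof.
move=> mB; have := mind 0 mB.
by congr measurable_fun; apply/funext => z; rewrite addr0.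
Qed.

Lemma convolution_integral (B : set R) : measurable B ->
  nu B = (\int[M]_z (\1_B (frac (z.1 + z.2)))%:E)%E.
Proof.
move=> mB; have mF : measurable_fun setT
    (fun z : R * R => (\1_B (frac (z.1 + z.2)))%:E : \bar R).
  by apply/measurable_EFinP; exact: mind0.
rewrite conv// fubini_tonelli1// [RHS](circle_integral I1)//; last 2 first.
- exact: measurable_fun_fubini_tonelli_F.
- by move=> x; apply: integral_ge0 => y _; rewrite lee_fin.
apply: eq_integral => x _; rewrite /fubini_F /=.
have mA : measurable [set y | B (frac (x + y))].
  rewrite -[X in measurable X]setTI.
  by apply: (measurableT_comp measurable_frac) => //; exact: measurable_funD.
transitivity (mu2 [set y | B (frac (x + y))]).
  by rewrite -(circle_measureI I2 mA) setIC.
by rewrite -[X in mu2 X]setIT -integral_indic.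
Qed.

(** The probability that both summands stay or both move by 1/2 when redrawn over their doubles; in
    both cases the sum is unchanged mod 1. *)
Definition agree (x y : R) : R := J1 x * J2 y + (1 - J1 x) * (1 - J2 y).

Let mJ1 := gdensity_measurable d1.
Let mJ2 := gdensity_measurable d2.

Let magree : measurable_fun setT (fun z : R * R => agree z.1 z.2).
Proof.
have m1 : measurable_fun setT (fun z : R * R => J1 z.1).
  exact: (measurableT_comp mJ1 measurable_fst).
have m2 : measurable_fun setT (fun z : R * R => J2 z.2).
  exact: (measurableT_comp mJ2 measurable_snd).
by apply: measurable_funD; apply: measurable_funM => //; exact: measurable_funB.
Qed.

Lemma agree_bounds c x y : (forall x, c <= J1 x <= 1 - c) -> 0 < c ->
  c <= agree x y <= 1 - c.
Proof.
move=> J1c c0; rewrite /agree; have := J1c x; have := gdensity_itv y d2.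
set j1 := J1 x; set j2 := J2 y => h2 h1.
by apply/andP; split; nra.
Qed.

(** [gibbs_split] acts inside the integral over [y] and, after exchanging the integrals, over [x].
    Of the four terms two have shift 1/2 and two none, since 1/2 + 1/2 is 0 on the circle. *)
Lemma convolution_split (B : set R) : measurable B ->
  (\int[M]_z (\1_B (frac (z.1 + z.2)))%:E =
   \int[M]_z (agree z.1 z.2 * \1_B (frac (z.1 + z.2)) +
     (1 - agree z.1 z.2) * \1_B (frac (z.1 + z.2 + 1 / 2)))%:E)%E.
Proof.
move=> mB.
have m1 : measurable_fun setT (fun z : R * R => J1 z.1).
  exact: (measurableT_comp mJ1 measurable_fst).
have m2 : measurable_fun setT (fun z : R * R => J2 z.2).
  exact: (measurableT_comp mJ2 measurable_snd).
have Ag0 x y : 0 <= agree x y by have := gdensity_itv x d1; have := gdensity_itv y d2; rewrite /agree; nra.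
have Ag1 x y : 0 <= 1 - agree x y.
  by have := gdensity_itv x d1; have := gdensity_itv y d2; rewrite /agree; nra.
rewrite fubini_tonelli1//=; last by apply/measurable_EFinP; exact: mind0.
rewrite [RHS]fubini_tonelli2//=; last 2 first.
- apply/measurable_EFinP; apply: measurable_funD; apply: measurable_funM => //.
  + exact: mind0.
  + exact: measurable_funB.
  + exact: mind.
- by move=> z; rewrite lee_fin addr_ge0// mulr_ge0// indicE.
pose G (z : R * R) := J2 z.2 * \1_B (frac (z.1 + z.2)) +
  (1 - J2 z.2) * \1_B (frac (z.1 + z.2 + 1 / 2)).
transitivity (\int[mu1]_x \int[mu2]_y (G (x, y))%:E)%E.
  by apply: eq_integral => x _; rewrite /fubini_F (gibbs_split_shift _ split2).
have mG : measurable_fun setT G.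
  apply: measurable_funD; apply: measurable_funM => //.
  + exact: mind0.
  + exact: measurable_funB.
  + exact: mind.
have G0 z : 0 <= G z.
  have /andP[/ltW h1 /ltW h2] := gdensity_itv z.2 d2.
  by rewrite /G addr_ge0// mulr_ge0// ?subr_ge0// indicE.
rewrite (fubini_tonelli (fun z => (G z)%:E))//; last first.
  exact/measurable_EFinP.
apply: eq_integral => y _; rewrite /fubini_G /G /=.
have j2 : 0 <= J2 y by have := gdensity_itv y d2; lra.
have j2' : 0 <= 1 - J2 y by have := gdensity_itv y d2; lra.
have ms a : measurable_fun setT (fun x : R => \1_B (frac (a + x)) : R).
  apply: (measurableT_comp (measurable_indic mB)).
  by apply: (measurableT_comp measurable_frac); exact: measurable_funD.
have mH a : measurable_fun setT (fun x : R =>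
    J1 x * \1_B (frac (a + x)) + (1 - J1 x) * \1_B (frac (a + x + 1 / 2)) : R).
  apply: measurable_funD; apply: measurable_funM => //; first exact: measurable_funB.
  have := ms (a + 1 / 2); congr measurable_fun; apply/funext => x.
  by rewrite addrAC.
have H0 a x : 0 <= J1 x * \1_B (frac (a + x)) +
    (1 - J1 x) * \1_B (frac (a + x + 1 / 2)) :> R.
  have /andP[/ltW h1 /ltW h2] := gdensity_itv x d1.
  by rewrite addr_ge0// mulr_ge0// ?subr_ge0// indicE.
transitivity ((J2 y)%:E * \int[mu1]_x (\1_B (frac (y + x)))%:E +
    (1 - J2 y)%:E * \int[mu1]_x (\1_B (frac (y + 1 / 2 + x)))%:E)%E.
  rewrite -!ge0_integralZl_EFin//; try exact/measurable_EFinP; try by move=> x _; rewrite lee_fin.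
  rewrite -ge0_integralD//; try by move=> x _; rewrite -EFinM lee_fin mulr_ge0.
  - apply: eq_integral => x _; rewrite -!EFinM -EFinD; congr (_ * \1_B (frac _) + _ * \1_B (frac _))%:E.
      exact: addrC.
    lra.
  - by apply: emeasurable_funM => //; exact/measurable_EFinP.
  - by apply: emeasurable_funM => //; exact/measurable_EFinP.
rewrite !(gibbs_split_shift _ split1)//.
rewrite -!ge0_integralZl_EFin//; try exact/measurable_EFinP; try by move=> x _; rewrite lee_fin.
rewrite -ge0_integralD//; try by move=> x _; rewrite -EFinM lee_fin mulr_ge0.
- apply: eq_integral => x _; rewrite -!EFinM -EFinD; congr EFin; rewrite /agree.
  have -> : y + x = x + y by rewrite addrC.
  have -> : y + 1 / 2 + x = x + y + 1 / 2 by lra.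
  have -> : x + y + 1 / 2 + 1 / 2 = x + y + 1 by field.
  by rewrite frac_periodic; ring.
- by apply: emeasurable_funM => //; exact/measurable_EFinP.
- by apply: emeasurable_funM => //; exact/measurable_EFinP.
Qed.

(** Doubling is additive, so it is removed from one summand at a time, by the invariance of the law
    of that summand. *)
Lemma convolution_invariant A : measurable A ->
  nu [set x | A (frac (2 * x))] = nu A.
Proof.
move=> mA; have mA' : measurable [set x : R | A (frac (2 * x))].
  rewrite -[X in measurable X]setTI.
  by apply: (measurableT_comp measurable_frac) => //; exact: measurable_funM.
rewrite !convolution_integral//.
have E (z : R) : \1_[set x | A (frac (2 * x))] (frac z) = \1_A (frac (2 * z)) :> R.
  have pf : periodic (fun x : R => \1_A (frac (2 * x)) : R).
    by have := periodic_pow2 1 (periodic_comp_frac (\1_A : R -> R)); rewrite expr1.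
  by rewrite -(periodic_frac z pf) !indicE.
under eq_integral do rewrite E.
have ms (a : R) : measurable_fun setT (fun x : R => (\1_A (frac (a + x)))%:E : \bar R).
  apply/measurable_EFinP; apply: (measurableT_comp (measurable_indic mA)).
  by apply: (measurableT_comp measurable_frac); exact: measurable_funD.
have pp (a : R) : periodic (fun x : R => (\1_A (frac (a + x)))%:E : \bar R).
  by move=> x; rewrite addrA frac_periodic.
have m1 : measurable_fun setT (fun z : R * R => (\1_A (frac (2 * z.1 + z.2)))%:E : \bar R).
  apply/measurable_EFinP; apply: (measurableT_comp (measurable_indic mA)).
  apply: (measurableT_comp measurable_frac).
  by apply: measurable_funD => //; exact: measurable_funM.
have m2 : measurable_fun setT (fun z : R * R => (\1_A (frac (2 * (z.1 + z.2))))%:E : \bar R).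
  apply/measurable_EFinP; apply: (measurableT_comp (measurable_indic mA)).
  apply: (measurableT_comp measurable_frac).
  exact: measurable_funM.
rewrite fubini_tonelli1//=.
rewrite [RHS]fubini_tonelli2//=; last by apply/measurable_EFinP; exact: mind0.
transitivity (\int[mu1]_x \int[mu2]_y (\1_A (frac (2 * x + y)))%:E)%E.
  apply: eq_integral => x _; rewrite /fubini_F /=.
  rewrite -(double2 (ms (2 * x)) (pp (2 * x))); last by move=> y; rewrite lee_fin.
  by apply: eq_integral => y _; rewrite mulrDr.
rewrite (fubini_tonelli (fun z : R * R => (\1_A (frac (2 * z.1 + z.2)))%:E))//.
apply: eq_integral => y _; rewrite /fubini_G /=.
under [RHS]eq_integral do rewrite addrC.
rewrite -(double1 (ms y) (pp y)); last by move=> x; rewrite lee_fin.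
by apply: eq_integral => x _; rewrite addrC.
Qed.

Let MT : M setT = 1%E.
Proof.
rewrite -[RHS](probability_setT nu) convolution_integral// -[LHS]mul1e -integral_cst//.
by apply: eq_integral => z _; rewrite indicT.
Qed.

Lemma convolution_circle : on_circle nu.
Proof.
rewrite /on_circle convolution_integral; last exact: measurable_I01.
rewrite -MT -[RHS]mul1e -integral_cst//; apply: eq_integral => z _.
by rewrite indicE mem_set//; exact: frac_I01.
Qed.

End Convolution.

(** * Maximal entropy *)

Section BinaryEntropyMax.
Context {R : realType}.

Lemma ln_lt_subr1 (x : R) : 0 < x -> x != 1 -> ln x < x - 1.
Proof.
move=> x0 x1; rewrite -ltr_expR lnK ?posrE//.
by have := @expR_gt1Dx R (x - 1); rewrite subr_eq0 [1 + _]addrC subrK; apply.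
Qed.

Lemma binary_entropy_half : binary_entropy (1 / 2 : R) = ln 2.
Proof.
rewrite binary_entropyE; last by lra.
have -> : 1 - 1 / 2 = 2^-1 :> R by field.
by rewrite div1r lnV ?posrE//; field.
Qed.

Lemma binary_entropy_le_ln2 (p : R) : 0 <= p <= 1 -> binary_entropy p <= ln 2.
Proof.
move=> p01; have h : 0 < (1 / 2 : R) < 1 by lra.
have := binary_entropy_le p01 h.
have -> : 1 - 1 / 2 = 2^-1 :> R by field.
by rewrite div1r lnV ?posrE// opprK -mulrDr addrC subrK mulr1.
Qed.

(** For [p] other than 1/2 the inequality [ln x < x - 1] is strict at [x = (2 * p)^-1], while the
    two upper bounds [e1] and [e2] add up to 0. *)
Lemma binary_entropy_eq_ln2 (p : R) : 0 < p < 1 -> binary_entropy p = ln 2 ->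
  p = 1 / 2.
Proof.
move=> /andP[p0 p1] E; apply/eqP; apply: contraT => ph.
have q0 : 0 < 1 - p by rewrite subr_gt0.
have h1 : ln ((2 * p)^-1) < (2 * p)^-1 - 1.
  apply: ln_lt_subr1; first by rewrite invr_gt0 mulr_gt0.
  rewrite invr_eq1; apply: contra ph => /eqP h; apply/eqP; lra.
have h2 : ln ((2 * (1 - p))^-1) <= (2 * (1 - p))^-1 - 1.
  by apply: ln_le_subr1; rewrite invr_gt0 mulr_gt0.
rewrite lnV ?posrE ?mulr_gt0// lnM ?posrE// in h1.
rewrite lnV ?posrE ?mulr_gt0// lnM ?posrE// in h2.
move: E; rewrite binary_entropyE ?p0// => E.
have h3 : p * (- (ln 2 + ln p)) < p * ((2 * p)^-1 - 1) by rewrite ltr_pM2l.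
have h4 : (1 - p) * (- (ln 2 + ln (1 - p))) <= (1 - p) * ((2 * (1 - p))^-1 - 1).
  by rewrite ler_pM2l.
have e1 : p * ((2 * p)^-1 - 1) = 1 / 2 - p by field; rewrite gt_eqF.
have e2 : (1 - p) * ((2 * (1 - p))^-1 - 1) = 1 / 2 - (1 - p).
  by field; rewrite gt_eqF.
rewrite e1 in h3; rewrite e2 in h4; lra.
Qed.

(* The argument on the right is the mixture of [p], [1 - p] and [1 / 2] with weights
   [j - c], [1 - j - c] and [2 * c]. *)
Lemma binary_entropy_mix (c j p : R) : 0 < c -> c <= j <= 1 - c -> 0 < p < 1 ->
  (1 - 2 * c) * binary_entropy p + 2 * c * ln 2 <=
  binary_entropy (j * p + (1 - j) * (1 - p)).
Proof.
move=> c0 jc p01; set q := j * p + (1 - j) * (1 - p).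
have q01 : 0 < q < 1 by apply/andP; split; rewrite /q; nra.
(* The same tangent, at [q], is used at [p], [1 - p] and [1 / 2]; the weighted average of these
   points is [q], so the right-hand sides combine to the entropy of [q]. *)
have h1 : binary_entropy p <= - ln q * p + - ln (1 - q) * (1 - p).
  by apply: binary_entropy_le => //; lra.
have h2 : binary_entropy p <= - ln q * (1 - p) + - ln (1 - q) * p.
  rewrite -binary_entropy1B -[X in _ + _ * X](subKr 1).
  by apply: binary_entropy_le => //; lra.
have h3 : ln 2 <= - ln q * (1 / 2) + - ln (1 - q) * (1 - 1 / 2).
  by rewrite -binary_entropy_half; apply: binary_entropy_le => //; lra.
rewrite (binary_entropyE q01).
have w1 : 0 <= j - c by lra.
have w2 : 0 <= 1 - j - c by lra.
have g1 := ler_wpM2l w1 h1; have g2 := ler_wpM2l w2 h2.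
have c2 : 0 <= 2 * c by lra.
have g3 := ler_wpM2l c2 h3.
rewrite /q in g1 g2 g3 *; lra.
Qed.

End BinaryEntropyMax.

Section GibbsEntropy.
Context {R : realType} (J : R -> R) (mu : probability R R).
Hypotheses (dJ : gdensity J) (muI : on_circle mu).
Hypothesis HG : forall phi : R -> R, continuous phi -> periodic phi ->
  (forall x, 0 <= phi x) ->
  (\int[mu]_y (ruelle J phi y)%:E = \int[mu]_y (phi y)%:E)%E.

Let J01 x : 0 < J x < 1. Proof. exact: gdensity_itv. Qed.

Lemma measurable_binary_entropy_density :
  measurable_fun setT (fun x => binary_entropy (J x)).
Proof.
have mJ := gdensity_measurable dJ.
have m1 : measurable_fun setT (fun t => 1 - J t) by exact: measurable_funB.
rewrite (_ : (fun t => _) = fun t => - ln (J t) * J t + - ln (1 - J t) * (1 - J t)).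
  by apply: measurable_funD; apply: measurable_funM => //;
    apply: measurableT_comp => //; apply: (measurableT_comp (@measurable_ln R)).
by apply/funext => t; rewrite binary_entropyE.
Qed.

Lemma binary_entropy_density_ge0 x : 0 <= binary_entropy (J x).
Proof. by apply: binary_entropy_ge0; have /andP[/ltW -> /ltW ->] := J01 x. Qed.

(** Duality replaces - ln J by its Ruelle image, and invariance evaluates that at [2 * x], over
    whose preimages [J] takes the values [J x] and [1 - J x]. *)
Lemma integral_ln_density :
  (\int[mu]_x (- ln (J x))%:E = \int[mu]_x (binary_entropy (J x))%:E)%E.
Proof.
have [_ pJ J0 _] := dJ.
pose phi x := - ln (J x).
have phi0 x : 0 <= phi x.
  by rewrite oppr_ge0 ln_le0//; have /andP[_ /ltW] := J01 x.
have cphi : continuous phi.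
  move=> x; have H : {for x, continuous (@ln R \o J)}.
    apply: continuous_comp; first exact: gdensity_continuous.
    exact: continuous_ln.
  exact: (cvgN H).
have pphi : periodic phi by move=> x; rewrite /phi pJ.
have mphi : measurable_fun setT phi by exact: continuous_measurable_fun.
rewrite -(HG cphi pphi phi0).
rewrite -(gibbs_integral_double dJ muI HG (f := fun y => (ruelle J phi y)%:E)).
- apply: eq_integral => x _; congr EFin; rewrite ruelleE binary_entropyE// /phi.
  have -> : 2 * x / 2 = x by field.
  have -> : (2 * x + 1) / 2 = x + 1 / 2 by field.
  by rewrite (gdensity_half x dJ); ring.
- by apply/measurable_EFinP; exact: measurable_ruelle.
- by move=> x; congr EFin; exact: ruelle_periodic.
- by move=> x; rewrite lee_fin; apply: ruelle_ge0.
Qed.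

Lemma gibbs_entropy_eq_ln2 :
  (\int[mu]_x (binary_entropy (J x))%:E = (ln 2)%:E)%E ->
  ae_eq mu setT J (cst (1 / 2)).
Proof.
move=> E.
have b0 x : 0 <= ln 2 - binary_entropy (J x).
  rewrite subr_ge0; apply: binary_entropy_le_ln2.
  by have /andP[/ltW -> /ltW ->] := J01 x.
have mb : measurable_fun setT (fun x => (ln 2 - binary_entropy (J x))%:E : \bar R).
  apply/measurable_EFinP; apply: measurable_funB => //.
  exact: measurable_binary_entropy_density.
have muT : mu setT = 1%E by exact: probability_setT.
have I0 : (\int[mu]_x (ln 2 - binary_entropy (J x))%:E = 0)%E.
  have : (\int[mu]_x (ln 2 - binary_entropy (J x))%:E +
      \int[mu]_x (binary_entropy (J x))%:E = (ln 2)%:E)%E.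
    rewrite -ge0_integralD//.
    + rewrite -[RHS]mule1 -[in RHS]muT -integral_cst//.
      by apply: eq_integral => x _; rewrite -EFinD subrK.
    + by move=> x _; rewrite lee_fin.
    + by move=> x _; rewrite lee_fin binary_entropy_density_ge0.
    + by apply/measurable_EFinP; exact: measurable_binary_entropy_density.
  rewrite E; case: (\int[mu]_x _)%E => [r||]//= [] h; congr EFin; lra.
have /ae_eq_integral_abs : (\int[mu]_x `|(ln 2 - binary_entropy (J x))%:E| = 0)%E.
  by rewrite -I0; apply: eq_integral => x _; rewrite gee0_abs// lee_fin.
move=> /(_ measurableT mb); apply: filterS => x /= H /H [] h.
by apply: binary_entropy_eq_ln2 => //; lra.
Qed.

End GibbsEntropy.

(** * Measures invariant under doubling and under the half turn *)

Section Lebesgue.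
Context {R : realType} (mu : probability R R).
Hypothesis muI : on_circle mu.
Hypothesis muT : forall A, measurable A -> mu [set x | A (frac (2 * x))] = mu A.
Hypothesis muS : forall A, measurable A ->
  mu [set x | A (frac (x + 1 / 2))] = mu A.

Let F (t : R) : R := fine (mu `[0, t[%classic).

Let mcc (a b : R) : measurable (`[a, b[%classic : set R).
Proof. exact: measurable_itv. Qed.

Let fmu (A : set R) : measurable A -> mu A \is a fin_num.
Proof. by move=> mA; exact: fin_num_measure. Qed.

Let mfrac (A : set R) : measurable A -> measurable [set x | A (frac x)].
Proof.
by move=> mA; rewrite -[X in measurable X]setTI; exact: measurable_frac.
Qed.

Let shift_half (t : R) : 0 <= t <= 1 / 2 ->
  mu `[1 / 2, 1 / 2 + t[%classic = mu `[0, t[%classic.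
Proof.
move=> t2; rewrite -(muS (mcc 0 t)) -(circle_measureI muI (mcc _ _)).
have mA : measurable [set x : R | `[0, t[%classic (frac (x + 1 / 2))].
  rewrite -[X in measurable X]setTI.
  by apply: (measurableT_comp measurable_frac) => //; exact: measurable_funD.
rewrite -(circle_measureI muI mA); congr (mu _).
have up (x : R) : 1 / 2 <= x < 1 -> frac (x + 1 / 2) = x - 1 / 2.
  move=> x2; rewrite (_ : x + 1 / 2 = x - 1 / 2 + 1); last by field.
  by rewrite frac_periodic frac_id// /I01 /=; lra.
apply/seteqP; split => x /= [+ xI]; rewrite !in_itv /= => H; split => //;
  move: (xI); rewrite /I01 /= => x01.
  by rewrite up; lra.
have [x2|x2] := ltP x (1 / 2).
  by move: H; rewrite frac_id ?/I01 /=; lra.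
by move: H; rewrite up; lra.
Qed.

(** The preimage of [0, t) under T is [0, t/2) together with its translate by 1/2, of the same
    measure. *)
Let F_half (t : R) : 0 <= t <= 1 -> F t = 2 * F (t / 2).
Proof.
move=> t01; rewrite /F -(muT (mcc 0 t)).
have mA : measurable [set x : R | `[0, t[%classic (frac (2 * x))].
  rewrite -[X in measurable X]setTI.
  by apply: (measurableT_comp measurable_frac) => //; exact: measurable_funM.
rewrite -(circle_measureI muI mA).
rewrite (_ : _ `&` _ = `[0, (t / 2)[%classic `|` `[1 / 2, (1 / 2 + t / 2)[%classic).
  rewrite measureU//; last first.
    by apply/seteqP; split => // x /=; rewrite !in_itv /=; lra.
  rewrite [X in (_ + X)%E](_ : _ = mu `[0, (t / 2)[%classic); last first.
    by apply: shift_half; lra.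
  by rewrite fineD ?fmu// mulr2n mulrDl mul1r.
apply/seteqP; split => x /=; rewrite !in_itv /=.
  rewrite /I01 /= => -[H xI]; have [x2|x2] := ltP x (1 / 2).
    by rewrite frac_id ?/I01 /= in H; lra.
  rewrite (_ : 2 * x = 2 * x - 1 + 1) in H; last by field.
  by rewrite frac_periodic frac_id ?/I01 /= in H; lra.
case=> H; rewrite /I01 /=; split; try lra.
  by rewrite frac_id ?/I01 /=; lra.
rewrite (_ : 2 * x = 2 * x - 1 + 1); last by field.
by rewrite frac_periodic frac_id ?/I01 /=; lra.
Qed.

Let F1 : F 1 = 1.
Proof.
by rewrite /F (_ : `[0, 1[%classic = @I01 R) ?muI.
Qed.

Let F_upper (t : R) : 1 / 2 <= t <= 1 -> F t = 1 / 2 + F (t - 1 / 2).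
Proof.
move=> t01; rewrite {1}/F.
rewrite (_ : `[0, t[%classic = `[0, (1 / 2)[%classic `|`
    `[1 / 2, (1 / 2 + (t - 1 / 2))[%classic).
  rewrite measureU//; last first.
    by apply/seteqP; split => // x /=; rewrite !in_itv /=; lra.
  rewrite [X in (_ + X)%E](_ : _ = mu `[0, (t - 1 / 2)[%classic); last first.
    by apply: shift_half; lra.
  rewrite fineD ?fmu// -/(F _) -/(F _); congr (_ + _).
  by have := @F_half 1; rewrite F1; lra.
by apply/seteqP; split => x /=; rewrite !in_itv /=; lra.
Qed.

(** On either half, the error [F s - s] is half the error at the doubled point. It is at most 1
    everywhere, hence at most 2^-n for every [n]. *)
Let F_id (t : R) : 0 <= t <= 1 -> F t = t.
Proof.
move=> t01.
have H n : forall s, 0 <= s <= 1 -> `|F s - s| <= (2 ^+ n)^-1.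
  elim: n => [|n IH] s s01.
    have F0 : 0 <= F s by exact: fine_ge0.
    have Fl1 : F s <= 1.
      by rewrite -lee_fin fineK ?fmu//; exact: probability_le1.
    by rewrite expr0 invr1 ler_norml; lra.
  have IH2 u : 0 <= u <= 1 -> `|F (u / 2) - u / 2| <= (2 ^+ n.+1)^-1.
    move=> u01; have -> : F (u / 2) - u / 2 = (F u - u) / 2.
      by rewrite (F_half u01); field.
    rewrite normrM [`|2^-1|]ger0_norm// exprS invfM mulrC.
    by rewrite ler_wpM2l// IH.
  have [s2|s2] := leP s (1 / 2).
    have -> : s = 2 * s / 2 by field.
    by apply: IH2; lra.
  rewrite F_upper; last by lra.
  have -> : 1 / 2 + F (s - 1 / 2) - s = F ((2 * s - 1) / 2) - (2 * s - 1) / 2.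
    by rewrite (_ : (2 * s - 1) / 2 = s - 1 / 2); field.
  by apply: IH2; lra.
apply/eqP; rewrite -subr_eq0 -normr_le0; apply/ler_addgt0Pr => e e0.
near \oo => n; rewrite add0r; apply: (le_trans (H n t t01)); apply: ltW.
rewrite -[X in X < _]mul1r; near: n.
exact: (near_infty_natSinv_expn_lt (PosNum e0)).
Unshelve. all: by end_near. Qed.

Lemma invariant_is_lebesgue : is_lebesgue mu.
Proof.
move=> A mA; have mI := @measurable_I01 R.
pose G := @RGenInftyO.G R.
pose g (n : nat) : set R := `]-oo, n%:R[%classic.
pose leb0 : {measure set (measurableTypeR R) -> \bar R} :=
  mrestr (@lebesgue_measure R) mI.
(* Pushing forward by the identity only moves the restricted Lebesgue measure to the measurable
   structure on which [mu] lives. *)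
pose leb : {measure set R -> \bar R} :=
  pushforward leb0 (idfun : measurableTypeR R -> R).
have mid : measurable_fun setT (idfun : measurableTypeR R -> R).
  by move=> _ B mB; rewrite setTI.
suff : mu A = leb mid A by [].
apply: (@measure_unique _ R _ G g _ _ _ _ mu (leb mid)) => //.
- exact: RGenInftyO.measurableE.
- move=> _ _ [x ->] [y ->]; exists (Num.min x y).
  by apply/seteqP; split => z /=; rewrite !in_itv /= lt_min;
    [move=> [-> ->]|move=> /andP].
- by move=> n; exists n%:R.
- apply/seteqP; split => // x _; exists (Num.truncn `|x|).+1 => //.
  rewrite /g /= in_itv /=; apply: (le_lt_trans (ler_norm x)).
  exact: truncnS_gt.
- move=> _ [t ->].
  pose s : R := Num.max 0 (Num.min t 1).
  have s01 : 0 <= s <= 1 by rewrite le_max lexx ge_max ler01 ge_min lexx orbT.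
  have E : `]-oo, t[%classic `&` @I01 R = `[0, s[%classic.
    apply/seteqP; split => x; rewrite /I01 /s /= !in_itv /= lt_max lt_min.
      by move=> [-> /andP[-> ->]]; rewrite orbT.
    by move=> /andP[x0 /orP[|/andP[-> ->]]]; [rewrite ltNge x0|rewrite x0].
  transitivity (mu (`]-oo, t[%classic `&` @I01 R)).
    by apply/esym; apply: (circle_measureI muI); exact: measurable_itv.
  have -> : leb mid `]-oo, t[%classic = lebesgue_measure (`[0, s[%classic : set R).
    by rewrite -E.
  rewrite E lebesgue_measure_itv /= -[LHS]fineK ?fmu// -/(F s) F_id//.
  rewrite lte_fin; case: ltP => s0; first by rewrite EFinN sube0.
  by congr EFin; lra.
- by move=> n; rewrite -ge0_fin_numE// fmu//; exact: measurable_itv.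
Qed.

End Lebesgue.

(** * Entropy of the convolution *)

(** For [y] in [0, 1) both preimages lie in [0, 1), where [J] and its periodic extension coincide;
    the rest of the line is a null set. *)
Lemma gibbs_frac {R : realType} (J : R -> R) (mu : probability R R) :
  gdensity (J \o frac) -> gibbs J mu ->
  forall phi : R -> R, continuous phi -> periodic phi -> (forall x, 0 <= phi x) ->
  (\int[mu]_y (ruelle (J \o frac) phi y)%:E = \int[mu]_y (phi y)%:E)%E.
Proof.
move=> dJ [muI HG] phi cphi pphi phi0.
have mphi : measurable_fun setT phi by exact: continuous_measurable_fun.
rewrite !(circle_integral muI).
- apply: eq_trans (HG _ (conj cphi pphi)); apply: eq_integral => y; rewrite inE /I01 /= => yI.
  by congr EFin; rewrite !ruelleE /= !frac_id// /I01 /=; lra.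
- exact/measurable_EFinP.
- by move=> x; rewrite lee_fin.
- by apply/measurable_EFinP; exact: measurable_ruelle.
- by move=> x; rewrite lee_fin; exact: ruelle_ge0.
Qed.

Section Entropy.
Context {R : realType} (J1 J2 : R -> R) (mu1 mu2 nu : probability R R).
Hypotheses (d1 : gdensity J1) (d2 : gdensity J2).
Hypotheses (I1 : on_circle mu1) (I2 : on_circle mu2).
Hypothesis G1 : forall phi : R -> R, continuous phi -> periodic phi ->
  (forall x, 0 <= phi x) ->
  (\int[mu1]_y (ruelle J1 phi y)%:E = \int[mu1]_y (phi y)%:E)%E.
Hypothesis G2 : forall phi : R -> R, continuous phi -> periodic phi ->
  (forall x, 0 <= phi x) ->
  (\int[mu2]_y (ruelle J2 phi y)%:E = \int[mu2]_y (phi y)%:E)%E.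
Hypothesis conv : convolution_of mu1 mu2 nu.

Let split1 := gibbs_split d1 I1 G1.
Let split2 := gibbs_split d2 I2 G2.
Let double1 := gibbs_integral_double d1 I1 G1.
Let double2 := gibbs_integral_double d2 I2 G2.
Let nuI := convolution_circle I1 I2 conv.
Let nuT := convolution_invariant I1 I2 double1 double2 conv.

Let M : {measure set (R * R) -> \bar R} := (mu1 \x mu2)%E.

Let s (z : R * R) : R := \1_(half ord0) (frac (z.1 + z.2)).

Let s01 z : s z = 0 \/ s z = 1.
Proof. by rewrite /s indicE; case: (_ \in _); [right|left]. Qed.

(** The conditional probability that the sum has first digit 0: [agree] if [z.1 + z.2] itself has
    that digit, its complement otherwise. *)
Let p (z : R * R) : R :=
  agree J1 J2 z.1 z.2 * s z + (1 - agree J1 J2 z.1 z.2) * (1 - s z).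

Let half1 (x : R) : \1_(half ord_max) (frac x) = 1 - \1_(half ord0) (frac x) :> R.
Proof.
have := frac_I01 x; rewrite /I01 !indicE /= => xI.
have [x2|x2] := ltP (frac x) (1 / 2).
  by rewrite memNset ?mem_set ?subrr// /half /=; lra.
by rewrite mem_set ?memNset ?subr0// /half /=; lra.
Qed.

Let half_shift (x : R) :
  \1_(half ord0) (frac (x + 1 / 2)) = 1 - \1_(half ord0) (frac x) :> R.
Proof.
rewrite -half1 -(periodic_frac x (f := fun x => \1_(half ord0) (frac (x + 1 / 2)) : R)); last first.
  by move=> y; rewrite addrAC frac_periodic.
have := frac_I01 x; set y := frac x; rewrite /I01 /= => yI.
have [y2|y2] := ltP y (1 / 2).
  by rewrite frac_id ?/I01 /= ?indicE; [rewrite !memNset// /half /=; lra|lra].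
rewrite (_ : y + 1 / 2 = y - 1 / 2 + 1); last by field.
rewrite frac_periodic frac_id ?/I01 /= ?indicE; last by lra.
by rewrite !mem_set// /half /=; lra.
Qed.

Let mhalf i : measurable (half i : set R). Proof. by case: (@half_partition R). Qed.

Let W (z : R * R) : R := frac (2 * (z.1 + z.2)).

Let mW : measurable_fun setT W.
Proof.
apply: (measurableT_comp measurable_frac); apply: measurable_funM => //.
exact: measurable_funD.
Qed.

(** The doubled point does not see a shift of the sum by 1/2, so its indicator factors out of both
    terms of [convolution_split]. *)
Let branchE i A : measurable A -> ((branch nu half i A)%:E =
  \int[M]_z ((agree J1 J2 z.1 z.2 * \1_(half i) (frac (z.1 + z.2)) +
    (1 - agree J1 J2 z.1 z.2) * \1_(half i) (frac (z.1 + z.2 + 1 / 2))) *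
    \1_A (W z))%:E)%E.
Proof.
move=> mA.
have mB : measurable [set x | half i (frac x) /\ A (frac (2 * x))].
  have m1 : measurable [set x : R | half i (frac x)].
    by rewrite -[X in measurable X]setTI; exact: measurable_frac.
  have m2 : measurable [set x : R | A (frac (2 * x))].
    rewrite -[X in measurable X]setTI.
    by apply: (measurableT_comp measurable_frac) => //; exact: measurable_funM.
  exact: measurableI m1 m2.
rewrite /branch fineK ?fin_num_measure//.
rewrite (convolution_integral I1 I2 conv mB) (convolution_split d1 d2 I1 I2 split1 split2 mB).
have E x : \1_[set x | half i (frac x) /\ A (frac (2 * x))] (frac x) =
    \1_(half i) (frac x) * \1_A (frac (2 * x)) :> R.
  have p2 : periodic (fun x : R => frac (2 * x)).
    by have := periodic_pow2 1 (@frac_periodic R); rewrite expr1.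
  rewrite !indicE -natrM mulnb; congr (_%:R); congr nat_of_bool.
  apply/idP/andP; rewrite !inE /= (periodic_frac x p2) (frac_id (frac_I01 x)) => -[] //.
apply: eq_integral => z _; congr EFin; rewrite !E /W.
have -> : 2 * (z.1 + z.2 + 1 / 2) = 2 * (z.1 + z.2) + 1 by field.
by rewrite frac_periodic; ring.
Qed.

Let br0 A : measurable A ->
  ((branch nu half ord0 A)%:E = \int[M]_z (p z * \1_A (W z))%:E)%E.
Proof.
move=> mA; rewrite branchE//; apply: eq_integral => z _.
by rewrite half_shift.
Qed.

Let br1 A : measurable A ->
  ((branch nu half ord_max A)%:E = \int[M]_z ((1 - p z) * \1_A (W z))%:E)%E.
Proof.
move=> mA; rewrite branchE//; apply: eq_integral => z _; congr (_ * _)%:E.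
by rewrite !half1 half_shift /p /s; ring.
Qed.

Let mp : measurable_fun setT p.
Proof.
have m1 : measurable_fun setT (fun z : R * R => J1 z.1).
  exact: (measurableT_comp (gdensity_measurable d1) measurable_fst).
have m2 : measurable_fun setT (fun z : R * R => J2 z.2).
  exact: (measurableT_comp (gdensity_measurable d2) measurable_snd).
have ma : measurable_fun setT (fun z : R * R => agree J1 J2 z.1 z.2).
  by apply: measurable_funD; apply: measurable_funM => //; exact: measurable_funB.
have ms : measurable_fun setT s.
  apply: (measurableT_comp (measurable_indic (mhalf ord0))).
  by apply: (measurableT_comp measurable_frac); exact: measurable_funD.
by apply: measurable_funD; apply: measurable_funM => //; exact: measurable_funB.
Qed.

Let be x := binary_entropy (J2 x).

Let mbe : measurable_fun setT be.
Proof. exact: measurable_binary_entropy_density. Qed.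

Let be0 x : 0 <= be x. Proof. exact: binary_entropy_density_ge0. Qed.

Let be_ln2 x : be x <= ln 2.
Proof.
by apply: binary_entropy_le_ln2; have /andP[/ltW -> /ltW ->] := gdensity_itv x d2.
Qed.

Let mu2T : mu2 setT = 1%E. Proof. exact: probability_setT. Qed.

Let int_le : (\int[mu2]_x (be x)%:E <= (ln 2)%:E)%E.
Proof.
rewrite -[leRHS]mule1 -mu2T -integral_cst//.
apply: ge0_le_integral => //.
- by move=> x _; rewrite lee_fin.
- exact/measurable_EFinP.
- by move=> x _; rewrite lee_fin.
Qed.

Definition gibbs_entropy : R := fine (\int[mu2]_x (be x)%:E)%E.

Let entE : (\int[mu2]_x (be x)%:E = gibbs_entropy%:E)%E.
Proof.
rewrite /gibbs_entropy fineK// ge0_fin_numE; first exact: le_lt_trans int_le (ltry _).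
by apply: integral_ge0 => x _; rewrite lee_fin.
Qed.

Lemma gibbs_entropy_le_ln2 : gibbs_entropy <= ln 2.
Proof. by rewrite -lee_fin -entE. Qed.

Lemma ks_entropy_gibbs_le : (ks_entropy mu2 <= gibbs_entropy%:E)%E.
Proof.
apply: ge_ereal_sup => _ [k [P [partP ->]]]; rewrite lee_fin.
apply: (h_part_le d2 I2 G2 _ partP).
by rewrite (integral_ln_density d2 I2 G2) entE.
Qed.

Lemma ks_entropy_convolution_ge : exists c : R, [/\ 0 < c, c < 1 / 2 &
  (((1 - 2 * c) * gibbs_entropy + 2 * c * ln 2)%:E <= ks_entropy nu)%E].
Proof.
have [c [c0 c2 J1c]] := gdensity_lbound d1; exists c; split => //.
apply: (@le_trans _ _ (h_part nu half)%:E); last first.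
  by apply: ereal_sup_ubound; exists 2%N, half; split => //; exact: half_partition.
rewrite lee_fin; apply: (h_part_ge nuI nuT) => n.
have pc z : c <= p z <= 1 - c.
  have := agree_bounds d2 z.1 z.2 J1c c0.
  by rewrite /p; case: (s01 z) => ->; rewrite ?subrr ?subr0 ?mulr0 ?mulr1 ?addr0 ?add0r; lra.
have W01 z : I01 (W z) by exact: frac_I01.
apply: (binary_entropy_defect (M := M) mW mp W01 c0 pc br0 br1).
have c2' : 0 <= 1 - 2 * c by lra.
have l0 : 0 <= 2 * c * ln 2 :> R by rewrite mulr_ge0 ?ln_ge0 ?ler1n// mulr_ge0// ltW.
rewrite EFinD EFinM -entE.
have mu1T : mu1 setT = 1%E by exact: probability_setT.
pose f x : R := (1 - 2 * c) * be x + 2 * c * ln 2.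
have mf : measurable_fun setT f by apply: measurable_funD => //; exact: measurable_funM.
have f0 x : 0 <= f x by rewrite /f addr_ge0// mulr_ge0.
rewrite (_ : (_ + _)%E = \int[M]_z (f z.2)%:E)%E; last first.
  rewrite fubini_tonelli1//=; last 2 first.
  - by apply/measurable_EFinP; exact: (measurableT_comp mf measurable_snd).
  - by move=> z; rewrite lee_fin.
  rewrite /fubini_F /=.
  rewrite [RHS](_ : _ = \int[mu2]_y (f y)%:E)%E; last first.
    by rewrite integral_cst// [X in (_ * X)%E]mu1T mule1.
  rewrite -ge0_integralZl_EFin//; last 2 first.
  - by move=> x _; rewrite lee_fin.
  - exact/measurable_EFinP.
  rewrite -[X in (_ + X)%E]mule1 -[X in (_ + _ * X)%E]mu2T -integral_cst//.
  rewrite -ge0_integralD//.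
  - by move=> x _; rewrite -EFinM lee_fin mulr_ge0.
  - by apply: emeasurable_funM => //; exact/measurable_EFinP.
apply: ge0_le_integral => //.
- by move=> z _; rewrite lee_fin.
- by apply/measurable_EFinP; exact: (measurableT_comp mf measurable_snd).
- apply/measurable_EFinP.
  rewrite (_ : (fun z => _) = fun z => - ln (p z) * p z + - ln (1 - p z) * (1 - p z)).
    have m1 : measurable_fun setT (fun z => 1 - p z) by exact: measurable_funB.
    by apply: measurable_funD; apply: measurable_funM => //;
      apply: measurableT_comp => //; apply: (measurableT_comp (@measurable_ln R)).
  by apply/funext => z; rewrite binary_entropyE//; have := pc z; lra.
- move=> z _; rewrite lee_fin /f /be.
  have H := binary_entropy_mix c0 (J1c z.1) (gdensity_itv z.2 d2).
  (* [p z] is [agree] or its complement, and binary entropy takes the same value at both. *)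
  apply: (le_trans H); rewrite -/(agree J1 J2 z.1 z.2) /p.
  case: (s01 z) => ->; rewrite ?subrr ?subr0 ?mulr0 ?mulr1 ?addr0 ?add0r//.
  by rewrite binary_entropy1B.
Qed.

(** Once the density is 1/2 almost everywhere, [gibbs_split] says that the measure of [A] is the
    mean of those of [A] and of its half turn, so the two are equal. *)
Lemma gibbs_entropy_eq_lebesgue : gibbs_entropy = ln 2 -> is_lebesgue mu2.
Proof.
move=> E; have Jae : ae_eq mu2 setT J2 (cst (1 / 2)).
  by apply: (gibbs_entropy_eq_ln2 d2); rewrite entE E.
apply: (invariant_is_lebesgue I2) => [A mA|A mA].
  exact: (gibbs_invariant d2 I2 G2).
have mS : measurable [set x : R | A (frac (x + 1 / 2))].
  rewrite -[X in measurable X]setTI.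
  by apply: (measurableT_comp measurable_frac) => //; exact: measurable_funD.
have mI (B : set R) (a : R) : measurable B ->
    measurable_fun setT (fun x : R => \1_B (frac (x + a)) : R).
  move=> mB; apply: (measurableT_comp (measurable_indic mB)).
  by apply: (measurableT_comp measurable_frac); exact: measurable_funD.
have mI0 (B : set R) : measurable B ->
    measurable_fun setT (fun x : R => \1_B (frac x) : R).
  by move=> mB; exact: (measurableT_comp (measurable_indic mB) measurable_frac).
have mJ := gdensity_measurable d2.
have shiftE : (\int[mu2]_x (\1_A (frac (x + 1 / 2)))%:E =
    mu2 [set x | A (frac (x + 1 / 2))])%E.
  by rewrite -[X in mu2 X]setIT -integral_indic.
have := split2 mA.
have -> : (\int[mu2]_x (J2 x * \1_A (frac x) + (1 - J2 x) * \1_A (frac (x + 1 / 2)))%:E =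
    (1 / 2)%:E * mu2 A + (1 / 2)%:E * mu2 [set x | A (frac (x + 1 / 2))])%E.
  rewrite -shiftE -(circle_integral_indic I2 mA).
  rewrite -!ge0_integralZl_EFin//; try by [move=> x _; rewrite lee_fin|apply/measurable_EFinP; auto].
  rewrite -ge0_integralD//; try by [move=> x _; rewrite -EFinM lee_fin mulr_ge0
    |apply: emeasurable_funM => //; apply/measurable_EFinP; auto].
  apply: ae_eq_integral => //.
  - apply/measurable_EFinP; apply: measurable_funD; apply: measurable_funM; auto.
    exact: measurable_funB.
  - by apply: emeasurable_funD; apply: emeasurable_funM => //; apply/measurable_EFinP; auto.
  - apply: filterS Jae => x /= H /H ->; rewrite -!EFinM -EFinD; congr EFin; lra.
rewrite -(fineK (fin_num_measure mu2 _ mA)) -(fineK (fin_num_measure mu2 _ mS)).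
by rewrite -!EFinM -EFinD => -[] h; congr EFin; lra.
Qed.

End Entropy.

Theorem theorem3 (R : realType) (J1 J2 : R -> R)
  (mu1 mu2 nu : probability R R) :
  (forall x, I01 x -> 0 < J1 x) -> holder_circle J1 -> normalized J1 ->
  (forall x, I01 x -> 0 < J2 x) -> holder_circle J2 -> normalized J2 ->
  gibbs J1 mu1 -> gibbs J2 mu2 ->
  convolution_of mu1 mu2 nu ->
  (ks_entropy mu2 <= ks_entropy nu)%E /\
  (~ is_lebesgue mu1 -> ~ is_lebesgue mu2 -> (ks_entropy mu2 < ks_entropy nu)%E).
Proof.
move=> J1p J1h J1n J2p J2h J2n g1 g2 conv.
have d1 := gdensity_frac J1p J1h J1n; have d2 := gdensity_frac J2p J2h J2n.
have G1 := gibbs_frac d1 g1; have G2 := gibbs_frac d2 g2.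
have [I1 _] := g1; have [I2 _] := g2.
have upper := ks_entropy_gibbs_le d2 I2 G2.
have le2 := gibbs_entropy_le_ln2 mu2 d2.
have [c [c0 c2 lower]] := ks_entropy_convolution_ge d1 d2 I1 I2 G1 G2 conv.
split.
  (* The two bounds differ by [2 * c] times the distance from [gibbs_entropy] to [ln 2]. *)
  apply: (le_trans upper); apply: le_trans lower; rewrite lee_fin; nra.
move=> _ nL; apply: (le_lt_trans upper); apply: lt_le_trans lower.
rewrite lte_fin.
have : gibbs_entropy (J2 \o frac) mu2 < ln 2.
  rewrite lt_neqAle le2 andbT; apply/eqP => E; apply: nL.
  exact: (gibbs_entropy_eq_lebesgue d2 I2 G2).
by nra.
Qed.
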